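(* Let $G$ be a planar graph that contains no kites and has maximum degree $\Delta(G)\geq 9$. Then $\chi''_l(G)=\Delta(G)+1$.
   Context: All graphs are finite and without loops or multiple edges. $\Delta(G)$ denotes the maximum degree of $G$. A kite is a subgraph formed by two (distinct) 3-cycles that share an edge; ''contains no kites'' means that no two distinct 3-cycles of $G$ share an edge. A proper total-coloring of $G$ assigns a color to each $x\in V(G)\cup E(G)$ so that adjacent vertices receive different colors, distinct edges sharing an endpoint receive different colors, and each edge receives a color different from the colors of its two endpoints. The list total chromatic number $\chi''_l(G)$ is the least integer $k$ such that, for every assignment $L$ of a list $L(x)$ of colors to each $x\in V(G)\cup E(G)$ with $|L(x)|\geq k$ for all $x$, there is a proper total-coloring of $G$ in which each $x$ receives a color from $L(x)$. *)

(* Defs.v *)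
From mathcomp Require Import all_boot all_order all_algebra.
From mathcomp Require Import finmap.
From mathcomp Require Import reals.

Set Implicit Arguments.
Unset Strict Implicit.
Unset Printing Implicit Defensive.

Import Order.TTheory GRing.Theory Num.Theory.

Record sgraph := SGraph {
  vertex :> finType;
  adj : rel vertex;
  adj_sym : symmetric adj;
  adj_irrefl : irreflexive adj
}.

Section Graphs.
Variable G : sgraph.

Definition degree (x : G) : nat := #|[set y | adj x y]|.

Definition max_degree : nat := \max_(x : G) degree x.

Definition edges : {set {set G}} :=
  [set e | [exists x, exists y, adj x y && (e == [set x; y])]].

Definition edge : Type := {e : {set G} | e \in edges}.

(* In a simple graph a 3-cycle is determined by its vertex set. *)
Definition triangle (A : {set G}) : bool :=
  (#|A| == 3) && [forall x in A, forall y in A, (x != y) ==> adj x y].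

Definition kite_free : Prop :=
  forall A B e : {set G}, triangle A -> triangle B ->
    e \in edges -> e \subset A -> e \subset B -> A = B.

Definition element : Type := (G + edge)%type.

Definition conflict (a b : element) : bool :=
  match a, b with
  | inl x, inl y => adj x y
  | inl x, inr e => x \in val e
  | inr e, inl x => x \in val e
  | inr e, inr f => (e != f) && (val e :&: val f != set0)
  end.

Definition proper_total_coloring (C : eqType) (c : element -> C) : Prop :=
  forall a b, conflict a b -> c a != c b.

Definition total_choosable (k : nat) : Prop :=
  forall (C : choiceType) (L : element -> {fset C}),
    (forall a, k <= #|` L a|) ->
    exists2 c : element -> C, proper_total_coloring c & forall a, c a \in L a.

Definition is_list_total_chromatic_number (k : nat) : Prop :=
  total_choosable k /\ forall j, total_choosable j -> k <= j.

End Graphs.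

Section Drawings.
Local Open Scope ring_scope.
Variable R : realType.

Definition on_segment (a b q : 'rV[R]_2) : Prop :=
  exists2 t : R, 0 <= t <= 1 & q = (1 - t) *: a + t *: b.

(* A polygonal curve is given by the sequence p of its successive corners. *)
Definition on_polyline (p : seq 'rV[R]_2) (q : 'rV[R]_2) : Prop :=
  exists2 i : nat, (i.+1 < size p)%N & on_segment p`_i p`_i.+1 q.

(* The curve has no self-intersection: two of its segments meet only if they  *)
(* are consecutive, and then only in their common corner.                     *)
Definition simple_polyline (p : seq 'rV[R]_2) : Prop :=
  uniq p /\
  forall (i j : nat) (q : 'rV[R]_2), (i < j)%N -> (j.+1 < size p)%N ->
    on_segment p`_i p`_i.+1 q -> on_segment p`_j p`_j.+1 q ->
    j = i.+1 /\ q = p`_j.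

(* As in the textbooks of Diestel and West, the edges of a plane drawing are  *)
(* polygonal arcs.                                                            *)
Record plane_drawing (G : sgraph) (pos : G -> 'rV[R]_2)
    (arc : edge G -> seq 'rV[R]_2) : Prop := PlaneDrawing {
  pos_inj : injective pos;
  arc_simple : forall e, simple_polyline (arc e);
  arc_ends : forall e, exists x y : G,
    [/\ val e = [set x; y], head 0 (arc e) = pos x & last 0 (arc e) = pos y];
  arc_vertex : forall e x, on_polyline (arc e) (pos x) -> x \in val e;
  arc_meet : forall e f q, e != f ->
    on_polyline (arc e) q -> on_polyline (arc f) q ->
    exists2 x, x \in val e :&: val f & q = pos x
}.

Definition planar (G : sgraph) : Prop :=
  exists (pos : G -> 'rV[R]_2) (arc : edge G -> seq 'rV[R]_2),
    plane_drawing pos arc.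

End Drawings.

(* Main.v *)
Require Import Defs.
From mathcomp Require Import all_boot all_order all_algebra.
From mathcomp Require Import finmap boolp reals.
From mathcomp Require Import ring lra zify.

(** The lower bound holds because a vertex of maximum degree and the edges at it
are pairwise in conflict ([total_choosable_gt_degree]).

For the upper bound put k for the maximum degree, fix lists of size k + 1, and
colour by induction on the number of edges, deleting edges but never vertices
([total_list_colorable]).  Two configurations can be removed and put back.

- A light edge uv, where deg u <= 4 and deg u + deg v <= k + 1: after the rest
  is coloured and u is uncoloured, the edge sees at most k colours, and then u
  sees at most 8 ([extend_light_edge]).

- An alternating subgraph: a nonempty set X of vertices of degree 2 such that
  every neighbour of X has exactly two neighbours in X.  The edges at X form
  disjoint even cycles.  When all other edges are coloured each edge at X keeps
  two colours, even cycles are 2-choosable ([two_regular_choosable]), and the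
  vertices of X are coloured last ([extend_alternator]).

If neither occurs, then by discharging ([many_deg2]) there are more vertices of
degree 2 than of degree k.  Here a vertex v starts with charge deg v - 4 and a
triangle with charge -1.  Every vertex of degree 5 or 6 gives 1/3, and every
vertex of degree at least 7 gives 1/2, to each triangle at it; every vertex
gives 1/3 to each neighbour of degree at most 3; and every vertex of degree k
puts 4/3 into a common pot, from which each vertex of degree 2 takes 4/3.  All
charges end nonnegative, because without kites the triangles at a vertex share
no edges; so only an overdrawn pot is consistent with the negative total.  But
in that case a minimal set of degree-2 vertices with no more neighbours than
elements spans an alternating subgraph ([alternating_subgraph]).

That the total charge is negative is a form of Euler's formula,
2 |E| + 4 <= 4 |V| + (number of triangles), for graphs without isolated
vertices ([euler_inequality]).  It is proved through cycle spaces, as in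
MacLane's planarity criterion, which avoids the Jordan curve theorem.  Give the
edges weights in a group of exponent two, so that the weights at each vertex add
up to zero.  Label a point off the drawing by the sum of the weights of the
edges met by the vertical ray above it.  The label is constant on every face,
and the labels on the two sides of an edge differ by the weight of that edge.
Hence, for each label phi, the edges with exactly one side labelled phi form the
boundary of a union of faces, and this set of edges is even at every vertex.
The property [face_labelled] records this, [planar_face_labelled] proves it, and
it passes to subgraphs at once, by giving the missing edges the weight 0.  For
suitable weights the boundaries span the whole cycle space.  So there are at
least |E| - |V| + 1 distinct nonempty ones; each of them is a triangle or has at
least four edges, and each edge lies in at most two of them. *)

Set Implicit Arguments.
Unset Strict Implicit.
Unset Printing Implicit Defensive.

Import Order.TTheory GRing.Theory Num.Theory.

(** * Labelling the sides of straight segments *)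

Section SegmentLabels.
Local Open Scope ring_scope.

Lemma affine_root (R : realFieldType) (p q x y : R) :
  p + q * x < 0 -> 0 < p + q * y ->
  exists2 z, p + q * z = 0 & (x < z < y) || (y < z < x).
Proof.
move=> hx hy.
have q0 : q != 0 by apply/eqP => q0; move: hx hy; rewrite q0; lra.
exists (- p / q); first by field.
have hz : q * (- p / q) = - p by field.
set z := - p / q in hz *.
have [qp|qn] : (0 < q) \/ (q < 0) by case: (ltgtP q 0) q0; auto.
- apply/orP; left; rewrite -(ltr_pM2l qp x) -(ltr_pM2l qp z) hz.
  by apply/andP; split; lra.
- apply/orP; right; rewrite -(ltr_nM2l qn z) -(ltr_nM2l qn x) hz.
  by apply/andP; split; lra.
Qed.

(** Read from top to bottom, the segments leaving a point cut its right side into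
sectors, and consecutive sectors carry labels that differ by the weight of the
segment between them.  Each inner sector is therefore counted twice, and only
the topmost and the lowest one survive. *)
Lemma sum_addb_telescope (R : realDomainType) (S : finType) (W : zmodType)
    (m : S -> R) (k : S -> W) (U phi : W) (A : {set S}) :
  {in A &, injective m} ->
  \big[addb/false]_(s in A)
    ((phi == U + \sum_(t in A | m s < m t) k t) (+)
     (phi == U + \sum_(t in A | m s < m t) k t + k s)) =
  (phi == U) (+) (phi == U + \sum_(t in A) k t).
Proof.
elim: {A}#|A| {-2}A (erefl #|A|) => [|n IH] A cA inj_m.
  by move/eqP: cA; rewrite cards_eq0 => /eqP ->; rewrite !big_set0 addr0 addbb.
have /set0Pn[s0 s0A] : A != set0 by rewrite -card_gt0 cA.
case: (arg_minP m s0A) => s sA s_min {s0 s0A}.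
have {}sA : s \in A := sA.
have cA' : #|A :\ s| = n by move: cA; rewrite (cardsD1 s) sA => -[].
have inj' : {in A :\ s &, injective m}.
  by move=> x y /setD1P[_ xA] /setD1P[_ yA]; apply: inj_m.
have lt_s t : t \in A -> t != s -> m s < m t.
  move=> tA ts; rewrite lt_neqAle s_min // andbT.
  by apply: contra ts => /eqP/inj_m ->.
rewrite (big_setD1 s) //= (eq_bigr (fun u =>
    (phi == U + \sum_(t in A :\ s | m u < m t) k t) (+)
     (phi == U + \sum_(t in A :\ s | m u < m t) k t + k u))); last first.
  move=> u /setD1P[us uA].
  have -> // : \sum_(t in A | m u < m t) k t = \sum_(t in A :\ s | m u < m t) k t.
  apply: eq_bigl => t; rewrite inE in_set1; case: eqVneq => //= ->.
  by rewrite (le_gtF (s_min _ uA)) andbF.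
rewrite (IH _ cA' inj').
have -> : \sum_(t in A | m s < m t) k t = \sum_(t in A :\ s) k t.
  apply: eq_bigl => t; rewrite inE in_set1.
  case: eqVneq => [->|ts]; first by rewrite ltxx andbF.
  by case tA: (t \in A) => //=; rewrite lt_s.
rewrite (big_setD1 s sA) /=.
set B := \sum_(t in A :\ s) k t; rewrite -addrA (addrC B).
by case: (phi == U); case: (phi == U + B); case: (phi == U + (k s + B)).
Qed.

(** Finitely many points of the plane, with abscissa [px] and ordinate [py], and
finitely many nonvertical segments; the segment [s] runs from [lp s] to [rp s]
along the line y = c s + m s * x.  Distinct points have distinct abscissas, so
that a vertical line moving to the right passes the points one at a time. *)
Record straight_drawing (R : realFieldType) (P S : finType) (px py : P -> R)
    (lp rp : S -> P) (c m : S -> R) : Prop := StraightDrawing {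
  abscissa_inj : injective px;
  left_lt_right : forall s, px (lp s) < px (rp s);
  height_left : forall s, c s + m s * px (lp s) = py (lp s);
  height_right : forall s, c s + m s * px (rp s) = py (rp s);
  segments_cross : forall s t x, s != t ->
    px (lp s) <= x <= px (rp s) -> px (lp t) <= x <= px (rp t) ->
    c s + m s * x = c t + m t * x ->
    exists p, [/\ (p == lp s) || (p == rp s), (p == lp t) || (p == rp t) & px p = x]
}.

Section Sweep.
Variables (R : realFieldType) (P S : finType) (px py : P -> R).
Variables (lp rp : S -> P) (c m : S -> R).
Hypothesis D : straight_drawing px py lp rp c m.
Local Notation lx s := (px (lp s)).
Local Notation rx s := (px (rp s)).
Local Notation h s x := (c s + m s * x).
Local Notation lr := (left_lt_right D).
Local Notation hl := (height_left D).

Definition above_at t s x :=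
  [/\ lx s <= x <= rx s, lx t <= x <= rx t & h s x < h t x].

Definition above t s : bool :=
  [&& lx s < rx t, lx t < rx s & `[< exists x, above_at t s x >]].

Lemma aboveI t s x : lx s < rx t -> lx t < rx s -> above_at t s x -> above t s.
Proof. by move=> h1 h2 h3; rewrite /above h1 h2; apply/asboolP; exists x. Qed.

(** Two segments that changed sides would cross at an abscissa strictly between
two others that they share, which is not an endpoint of either. *)
Lemma above_ge t s x : above t s -> lx s <= x <= rx s -> lx t <= x <= rx t ->
  h s x <= h t x.
Proof.
move=> /and3P[h1 h2 /asboolP[y [y1 y2 hy]]] x1 x2; rewrite leNgt; apply/negP => hx.
have st : s != t by apply/eqP => e; move: hy; rewrite e ltxx.
have [||z z0 zxy] := @affine_root R (c t - c s) (m t - m s) x y; try lra.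
have [] := @segments_cross _ _ _ _ _ _ _ _ _ D s t z st; try lra.
move=> p [/orP[]/eqP-> /orP[]/eqP ep pz]; move: (lr s) (lr t) x1 x2 y1 y2 zxy; rewrite -pz.
- by move=> _ _ /andP[? ?] _ /andP[? ?] _ /orP[]/andP[]; lra.
- by move=> _ _ /andP[? ?] _ /andP[? ?] _ /orP[]/andP[]; lra.
- by move=> _ _ /andP[? ?] _ /andP[? ?] _ /orP[]/andP[]; lra.
- by move=> _ _ /andP[? ?] _ /andP[? ?] _ /orP[]/andP[]; lra.
Qed.

Lemma no_crossing_inside t s x : s != t -> lx s < x < rx s -> lx t <= x <= rx t ->
  h s x != h t x.
Proof.
move=> st x1 x2; apply/eqP => e.
have [] := @segments_cross _ _ _ _ _ _ _ _ _ D s t x st; rewrite ?x2 //.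
  by move: x1; lra.
by move=> p [/orP[]/eqP-> _ pz]; move: x1; rewrite pz ltxx ?andbF.
Qed.

Definition over t v := (lx t < px v < rx t) && (py v < h t (px v)).
Definition inside_above s v := (lx s < px v < rx s) && (h s (px v) < py v).

Lemma above_start t s : (above t s && (lx s < lx t)) = inside_above s (lp t).
Proof.
apply/andP/andP => -[].
  move=> ab st; have /and3P[_ tr _] := ab; split; first by rewrite st.
  have tl := lr t.
  rewrite -hl lt_neqAle (above_ge ab) ?andbT; try lra.
  apply: no_crossing_inside; try lra.
  by apply: contraTneq st => ->; rewrite ltxx.
move=> /andP[st ts] hh; split=> //.
have tl := lr t; apply: (@aboveI _ _ (lx t)); try lra.
by split; [lra|lra|rewrite hl].
Qed.

Lemma above_over v t s : lp s = v -> (above t s && (lx t < lx s)) = over t v.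
Proof.
move=> <-; apply/andP/andP => -[].
  move=> ab ts; have /and3P[tr _ _] := ab; split; first by rewrite ts.
  have sl := lr s.
  rewrite -hl lt_neqAle (above_ge ab) ?andbT; try lra.
  rewrite eq_sym; apply: no_crossing_inside; try lra.
  by apply: contraTneq ts => ->; rewrite ltxx.
move=> /andP[st ts] hh; split=> //.
have sl := lr s; apply: (@aboveI _ _ (lx s)); try lra.
by split; [lra|lra|rewrite hl].
Qed.

Lemma above_common_start s t : lp s = lp t -> above t s = (m s < m t).
Proof.
move=> e; have e1 := hl s; have e2 := hl t; have sl := lr s; have tl := lr t.
have pos x : lx s < x -> (h s x < h t x) = (m s < m t).
  move=> sx; have -> : h s x = py (lp s) + m s * (x - lx s) by rewrite -e1; ring.
  have -> : h t x = py (lp s) + m t * (x - lx s) by rewrite e -e2; ring.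
  by rewrite ltrD2l ltr_pM2r // subr_gt0.
apply/idP/idP.
  move=> /and3P[_ _ /asboolP[x [x1 x2 hx]]].
  rewrite -(pos x) // lt_neqAle; case/andP: x1 => -> _; rewrite andbT.
  by apply: contraTneq hx => <-; rewrite e1 e e2 ltxx.
move=> mst; have e' : lx s = lx t by rewrite e.
clear e.
have [le|lt] := leP (rx s) (rx t).
  apply: (@aboveI _ _ (rx s)); try lra.
  by split; [lra|lra|rewrite pos].
apply: (@aboveI _ _ (rx t)); try lra.
by split; [lra|lra|rewrite pos //; lra].
Qed.

Lemma slope_inj v : {in [set s | lp s == v] &, injective m}.
Proof.
move=> s t; rewrite !inE => /eqP es /eqP et emt; apply/eqP/negPn/negP => st.
have e : lx s = lx t by rewrite es et.
have ey : py (lp s) = py (lp t) by rewrite es et.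
clear es et.
have sl := lr s; have tl := lr t.
have [x [xs xt]] : exists x, lx s < x < rx s /\ lx t <= x <= rx t.
  rewrite -e in tl *; have [le|lt] := leP (rx s) (rx t).
    by exists ((lx s + rx s) / 2); split; lra.
  by exists ((lx s + rx t) / 2); split; lra.
have /eqP := no_crossing_inside st xs xt; apply.
by move: (hl s); rewrite ey -hl emt e => /addIr ->.
Qed.

Section Labels.
Variables (W : zmodType) (k : S -> W).

(** The label of the upper side of [s] just to the right of its left end: the sum
of the weights met by a vertical ray from there. *)
Definition label s : W := \sum_(t | above t s && (lx t <= lx s)) k t.
Definition vlabel v : W := \sum_(t | over t v) k t.

Lemma label_start v s : lp s = v ->
  label s = vlabel v + \sum_(t in [set s | lp s == v] | m s < m t) k t.
Proof.
move=> e; rewrite /label (bigID (fun t => lx t < lx s)) /=; congr (_ + _).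
  apply: eq_bigl => t; rewrite -(above_over _ e) -andbA; congr (_ && _).
  by case: ltgtP.
apply: eq_bigl => t; rewrite inE -leNgt -andbA -eq_le.
rewrite (inj_eq (abscissa_inj D)) e; case: eqP => [et|_]; rewrite ?andbF //= andbT.
by rewrite above_common_start // e et.
Qed.

Lemma sum_starts v phi :
  \big[addb/false]_(s | lp s == v) ((phi == label s) (+) (phi == label s + k s)) =
  (phi == vlabel v) (+) (phi == vlabel v + \sum_(s | lp s == v) k s).
Proof.
have := sum_addb_telescope k (vlabel v) phi (@slope_inj v).
rewrite (eq_bigl (fun s => lp s == v)); last by move=> s; rewrite inE.
rewrite [X in _ = _ (+) (_ == _ + X)](eq_bigl (fun s => lp s == v)); last first.
  by move=> s; rewrite inE.
by move=> <-; apply: eq_bigr => s /eqP e; rewrite (label_start e).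
Qed.

Lemma sum_above s :
  \sum_(t | above t s) k t = label s + \sum_(v | inside_above s v) \sum_(t | lp t == v) k t.
Proof.
rewrite (bigID (fun t => lx t <= lx s)) /=; congr (_ + _).
rewrite (eq_bigl (fun t => inside_above s (lp t))); last first.
  by move=> t; rewrite -above_start ltNge.
rewrite (partition_big lp (inside_above s)) //=.
apply: eq_bigr => v iv; apply: eq_bigl => t.
by case: eqP => [->|_]; rewrite ?iv ?andbF.
Qed.

End Labels.
End Sweep.

Section Balanced.
Variables (R : realFieldType) (P S : finType) (px py : P -> R).
Variables (lp rp : S -> P) (c m : S -> R).
Hypothesis D : straight_drawing px py lp rp c m.
Variables (W : zmodType) (k : S -> W).
Hypothesis char2 : forall x : W, x + x = 0.
Hypothesis k_balanced : forall p, \sum_(s | (p == lp s) || (p == rp s)) k s = 0.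
(* Reflection in a vertical line exchanges the left and right ends. *)
Local Notation npx := (fun p => - px p).
Local Notation nm := (fun s => - m s).

Lemma sum_touching (X : Type) (idx : X) (op : Monoid.com_law idx) (g : S -> X) p :
  \big[op/idx]_(s | (p == lp s) || (p == rp s)) g s =
  op (\big[op/idx]_(s | lp s == p) g s) (\big[op/idx]_(s | rp s == p) g s).
Proof.
rewrite (bigID (fun s => lp s == p)) /=; congr (op _ _); apply: eq_bigl => s.
  by rewrite (eq_sym p (lp s)); case: (lp s == p); rewrite ?andbF.
rewrite ![p == _]eq_sym; case: eqP => [e|_] /=; last by rewrite andbT.
by apply/esym/negbTE/eqP => e'; have := left_lt_right D s; rewrite e e' ltxx.
Qed.

Lemma straight_drawing_reflect : straight_drawing npx py rp lp c nm.
Proof.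
split=> [x y /oppr_inj/(abscissa_inj D) //|s|s|s|s t x st x1 x2 hx].
- by rewrite ltrN2 (left_lt_right D).
- by rewrite mulrNN (height_right D).
- by rewrite mulrNN (height_left D).
have [||||p [p1 p2 e]] := @segments_cross _ _ _ _ _ _ _ _ _ D s t (- x); try lra.
  by [].
by exists p; rewrite e opprK orbC p1 orbC p2.
Qed.

Lemma above_reflect t s : above npx rp lp c nm t s = above px lp rp c m t s.
Proof.
rewrite /above !ltrN2 andbCA; do 2! congr (_ && _).
by apply: asbool_equiv_eq; split=> -[x [x1 x2 hx]]; exists (- x); split; lra.
Qed.

(** The label of the upper side is the same at both ends of [s].  The two sums
differ by the segments above [s] that start, or end, strictly within its range;
grouped by their endpoints these are all the segments at the points above [s],
and the weights at a point cancel. *)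
Lemma label_reflect s : label px lp rp c m k s = label npx rp lp c nm k s.
Proof.
have := sum_above D k s; rewrite (eq_bigl _ _ (fun t => esym (above_reflect t s))).
rewrite (sum_above straight_drawing_reflect k s).
rewrite [X in _ + X = _](eq_bigl (inside_above px py lp rp c m s)); last first.
  by move=> v; rewrite /inside_above !ltrN2 mulrNN [X in X && _]andbC.
set A := (X in _ + X = _); set B := (X in _ = _ + X) => e.
have AB : A + B = 0.
  rewrite /A /B -big_split big1 //= => v _; rewrite addrC -(sum_touching +%R k v).
  exact: k_balanced.
have -> : label px lp rp c m k s = (label px lp rp c m k s + B) + A.
  by rewrite -addrA (addrC B) AB addr0.
by rewrite -e -addrA char2 addr0.
Qed.

(** Around a point, the sectors on the right run from the label above the point to
the label below it, and so do the sectors on the left. *)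
Lemma straight_face_labels : exists l : S -> W, forall phi p,
  \big[addb/false]_(s | (p == lp s) || (p == rp s))
    ((phi == l s) (+) (phi == l s + k s)) = false.
Proof.
exists (label px lp rp c m k) => phi p; rewrite sum_touching (sum_starts D).
rewrite (eq_bigr (fun s => (phi == label npx rp lp c nm k s) (+)
    (phi == label npx rp lp c nm k s + k s))); last first.
  by move=> s _; rewrite label_reflect.
rewrite (sum_starts straight_drawing_reflect).
have -> : vlabel npx py rp lp c nm k p = vlabel px py lp rp c m k p.
  by apply: eq_bigl => t; rewrite /over !ltrN2 mulrNN [X in X && _]andbC.
have -> : \sum_(s | rp s == p) k s = \sum_(s | lp s == p) k s.
  have := k_balanced p.
  rewrite sum_touching => /(congr1 (+%R (\sum_(s | lp s == p) k s))).
  by rewrite addrA char2 addr0 add0r.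
exact: addbb.
Qed.

End Balanced.
End SegmentLabels.

(** * From plane drawings to face labels *)

Section FaceLabels.
Local Open Scope ring_scope.

(** With [k] the weights of the edges, [l e] and [l e + k e] are the labels of the
two sides of [e].  The conclusion says that the edges with exactly one side
labelled [phi] have even degree at [v]. *)
Definition face_labelled (V : finType) (F : {set {set V}}) : Prop :=
  forall (W : zmodType) (k : {set V} -> W),
    (forall x : W, x + x = 0) ->
    (forall v, \sum_(e in F | v \in e) k e = 0) ->
  exists l : {set V} -> W, forall phi v,
    \big[addb/false]_(e in F | v \in e) ((phi == l e) (+) (phi == l e + k e)) = false.

Lemma face_labelled_subset (V : finType) (F F' : {set {set V}}) :
  F' \subset F -> face_labelled F -> face_labelled F'.
Proof.
move=> sF labF W k char2 bal; pose k' e := if e \in F' then k e else 0.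
have restrict (X : Type) (idx : X) (op : Monoid.com_law idx) (f f' : {set V} -> X) v :
    {in F', f =1 f'} -> (forall e, e \notin F' -> f' e = idx) ->
    \big[op/idx]_(e in F' | v \in e) f e = \big[op/idx]_(e in F | v \in e) f' e.
  move=> ff' f0; rewrite [RHS](bigID (mem F')) /= [X in op _ X]big1 ?Monoid.mulm1.
    apply: eq_big => [e|e /andP[/ff' //]].
    by case eF: (e \in F'); rewrite ?andbT ?andbF // (subsetP sF).
  by move=> e /andP[_ /f0].
have [|l lP] := labF W k' char2.
  move=> v; rewrite -(restrict W 0 +%R k) //; first by move=> e eF; rewrite /k' eF.
  by move=> e /negbTE eF; rewrite /k' eF.
exists l => phi v; rewrite -[RHS](lP phi v); apply: restrict => e.
  by move=> eF; rewrite /k' eF.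
by move=> /negbTE eF; rewrite /k' eF addr0 addbb.
Qed.

(** Only finitely many shears make the abscissas of two of the given points agree,
and [lam] is larger than all of them. *)
Lemma generic_shear (R : realFieldType) (ps : seq 'rV[R]_2) :
  exists lam, {in ps &, injective (fun p : 'rV[R]_2 => p 0 0 + lam * p 0 1)}.
Proof.
pose bad := [seq (q 0 0 - p 0 0) / (p 0 1 - q 0 1) | p : 'rV[R]_2 <- ps, q : 'rV[R]_2 <- ps].
exists (1 + \sum_(b <- bad) `|b|) => p q pin qin; set lam := 1 + _ => e.
have lam_bad : lam \notin bad.
  apply/negP => lb; have : lam <= \sum_(b <- bad) `|b|.
    rewrite (big_rem lam lb) /= (le_trans (ler_norm lam)) // lerDl.
    by apply: sumr_ge0 => b _; apply: normr_ge0.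
  by rewrite /lam; lra.
have e1 : p 0 1 = q 0 1.
  apply/eqP/negPn/negP => ne; case/negP: lam_bad.
  have -> : lam = (q 0 0 - p 0 0) / (p 0 1 - q 0 1).
    apply: (canRL (mulfK _)); first by rewrite subr_eq0.
    by move: e; lra.
  by apply: allpairs_f.
have e0 : p 0 0 = q 0 0 by move: e; rewrite e1 => /addIr.
apply/rowP => -[[|[|//]] i].
  by rewrite (_ : Ordinal i = 0) //; apply: val_inj.
by rewrite (_ : Ordinal i = 1) //; apply: val_inj.
Qed.

Lemma on_segment_sym (R : realType) (a b q : 'rV[R]_2) : on_segment a b q -> on_segment b a q.
Proof.
case=> t t01 ->; exists (1 - t); first by lra.
by rewrite opprB addrC subrKC addrC.
Qed.

Lemma on_segment_l (R : realType) (a b : 'rV[R]_2) : on_segment a b a.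
Proof. by exists 0; rewrite ?lexx ?ler01 // subr0 scale1r scale0r addr0. Qed.

Lemma on_segment_r (R : realType) (a b : 'rV[R]_2) : on_segment a b b.
Proof. by apply: on_segment_sym; apply: on_segment_l. Qed.

Lemma corner_on_segment (R : realType) (p : seq 'rV[R]_2) i j : simple_polyline p ->
  (1 < size p)%N -> (i.+1 < size p)%N -> (j < size p)%N ->
  on_segment p`_i p`_i.+1 p`_j -> j = i \/ j = i.+1.
Proof.
move=> [up simp] sp si sj on.
have corner a b : (a < size p)%N -> (b < size p)%N -> p`_a = p`_b -> a = b.
  by move=> sa sb /eqP; rewrite nth_uniq // => /eqP.
have [sj1|sj1] := ltnP j.+1 (size p).
  have [ji|ij|->] := ltngtP j i; last by left.
    have [-> /corner e] := simp j i _ ji si (on_segment_l _ _) on.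
    by have := e sj sj1; lia.
  by have [-> _] := simp i j _ ij sj1 on (on_segment_l _ _); right.
have j0 : (j = j.-1.+1)%N by lia.
have on' : on_segment p`_j.-1 p`_j.-1.+1 p`_j by rewrite -j0; apply: on_segment_r.
have [ji|ij|ji] := ltngtP j.-1 i; [lia| |right; lia].
have sj2 : (j.-1.+1 < size p)%N by lia.
have [_ /corner e] := simp i j.-1 _ ij sj2 on on'.
by have := e sj (ltnW sj2); lia.
Qed.

Section Drawing.
Variables (R : realType) (G : sgraph) (pos : G -> 'rV[R]_2) (arc : edge G -> seq 'rV[R]_2).
Hypothesis D : plane_drawing pos arc.
Implicit Types (e f : edge G) (v : G).

Lemma edge_ends (e : edge G) : exists x y : G, [/\ val e = [set x; y], x != y,
  (arc e)`_0%N = pos x & (arc e)`_(size (arc e)).-1 = pos y].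
Proof.
have [x [y [exy hx ly]]] := arc_ends D e; exists x, y; split=> //.
- have := valP e; rewrite inE => /existsP[a /existsP[b /andP[ab /eqP eab]]].
  apply/eqP => xy; have : #|val e| = 2%N.
    by rewrite eab cards2; case: eqP ab => // ->; rewrite adj_irrefl.
  by rewrite exy xy setUid cards1.
- by rewrite nth_last.
Qed.

Lemma arc_size e : (1 < size (arc e))%N.
Proof.
have [x [y [_ xy ex ey]]] := edge_ends e; rewrite ltnNge; apply/negP => s1.
have e0 : (size (arc e)).-1 = 0%N by lia.
by move: ey; rewrite e0 ex => /(pos_inj D)/eqP; rewrite (negbTE xy).
Qed.

Lemma arc_nth_inj e i j : (i < size (arc e))%N -> (j < size (arc e))%N ->
  (arc e)`_i = (arc e)`_j -> i = j.
Proof.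
by move=> si sj /eqP; rewrite nth_uniq //; [move/eqP|case: (arc_simple D e)].
Qed.

Definition segment := {e : edge G & 'I_(size (arc e)).-1}.
Definition seg e (i : 'I_(size (arc e)).-1) : segment := Tagged (fun e => 'I_(size (arc e)).-1) i.
Implicit Types (s t : segment) (q : 'rV[R]_2).
Definition src (s : segment) := (arc (tag s))`_(tagged s).
Definition dst (s : segment) := (arc (tag s))`_(tagged s).+1.
Definition touches q s := (q == src s) || (q == dst s).

Lemma seg_size (s : segment) : ((tagged s).+1 < size (arc (tag s)))%N.
Proof. by case: s => e i /=; have := ltn_ord i; have := arc_size e; lia. Qed.

Lemma on_seg_polyline s q : on_segment (src s) (dst s) q -> on_polyline (arc (tag s)) q.
Proof. by move=> on; exists (tagged s); first exact: seg_size. Qed.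

Lemma vertex_corner e v : v \in val e ->
  exists2 j, (j == 0%N) || (j == (size (arc e)).-1) & (arc e)`_j = pos v.
Proof.
have [x [y [-> _ ex ey]]] := edge_ends e; rewrite !inE => /orP[]/eqP->.
  by exists 0%N.
by exists (size (arc e)).-1; rewrite ?eqxx ?orbT.
Qed.

Lemma vertex_on_segment s v : v \in val (tag s) ->
  on_segment (src s) (dst s) (pos v) -> touches (pos v) s.
Proof.
case: s => e i /=; move/vertex_corner => [j js <-] on.
have ss := arc_size e; have si := seg_size (seg i); rewrite /= in si.
have [|ji|ji] := corner_on_segment (arc_simple D e) ss si _ on; first by case/orP: js => /eqP->; lia.
  by rewrite /touches /src /= ji eqxx.
by rewrite /touches /dst /= ji eqxx orbT.
Qed.

(** Segments of different arcs can only meet in a vertex, which is an end of both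
arcs, and segments of one arc only in the corner between them. *)
Lemma segments_meet s t q : s != t -> on_segment (src s) (dst s) q ->
  on_segment (src t) (dst t) q -> touches q s && touches q t.
Proof.
move=> st qs qt; have [est|nst] := eqVneq (tag s) (tag t); last first.
  have [v /setIP[vs vt] qv] := arc_meet D nst (on_seg_polyline qs) (on_seg_polyline qt).
  by rewrite qv in qs qt *; rewrite !vertex_on_segment.
case: s t est st qs qt => e i [e' j] /= est; case: e' / est j => j st qs qt.
have si := seg_size (seg i); have sj := seg_size (seg j); rewrite /= in si sj.
have [_ simp] := arc_simple D e.
have [ij|ji|ij] := ltngtP i j.
- have [ji ->] := simp i j q ij sj qs qt.
  by rewrite /touches /src /dst /= ji !eqxx !orbT.
- have [ij ->] := simp j i q ji si qt qs.
  by rewrite /touches /src /dst /= ij !eqxx !orbT.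
- by case/eqP: st; congr existT; apply: val_inj.
Qed.

Section SumOver.
Variables (X : Type) (idx : X) (op : Monoid.com_law idx).

(** Each arc ending at [pos v] contributes exactly one segment there. *)
Lemma sum_at_vertex (f : edge G -> X) v :
  \big[op/idx]_(s | touches (pos v) s) f (tag s) = \big[op/idx]_(e : edge G | v \in val e) f e.
Proof.
transitivity (\big[op/idx]_(e : edge G)
    \big[op/idx]_(i < (size (arc e)).-1 | touches (pos v) (seg i)) f e).
  rewrite (sig_big_dep xpredT (fun e i => touches (pos v) (seg i)) (fun e _ => f e)) /=.
  by apply: eq_bigl => -[].
rewrite [RHS]big_mkcond /=; apply: eq_bigr => e _.
have ss := arc_size e.
have [x [y [exy xy ex ey]]] := edge_ends e.
case ve: (v \in val e); last first.
  apply: big_pred0 => i; apply/negP => ti; move/negP: ve; apply.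
  apply: (arc_vertex D); apply: (@on_seg_polyline (seg i)).
  by case/orP: ti => /eqP->; [apply: on_segment_l|apply: on_segment_r].
have tE j (i : 'I_(size (arc e)).-1) : (j < size (arc e))%N -> (arc e)`_j = pos v ->
    touches (pos v) (seg i) = (j == i) || (j == i.+1).
  move=> sj <-; have si := ltn_ord i; have [u _] := arc_simple D e.
  have si1 : (i < size (arc e))%N by lia.
  have si2 : (i.+1 < size (arc e))%N by lia.
  by rewrite /touches /src /dst /= !nth_uniq.
have s0 : (0 < (size (arc e)).-1)%N by lia.
have s1 : ((size (arc e)).-2 < (size (arc e)).-1)%N by lia.
move: ve; rewrite exy !inE => /orP[]/eqP ve.
  rewrite (big_pred1 (Ordinal s0)) // => i.
  by rewrite (tE 0%N) ?ve // ?orbF -?val_eqE /= 1?eq_sym //; lia.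
rewrite (big_pred1 (Ordinal s1)) // => i.
rewrite (tE (size (arc e)).-1) ?ve //; last by lia.
change (pred1 (Ordinal s1) i) with (nat_of_ord i == (size (arc e)).-2).
have := ltn_ord i; move: (nat_of_ord i) ss; clear.
by move: (size _) => n a; lia.
Qed.

(** Other arcs avoid this corner, because arcs share only vertices of the graph,
and these are ends of arcs. *)
Lemma sum_at_bend (g : segment -> X) e (i : 'I_(size (arc e)).-1) (j : 'I_(size (arc e)).-1) :
  i.+1 = j :> nat ->
  \big[op/idx]_(s | touches (arc e)`_j s) g s = op (g (seg i)) (g (seg j)).
Proof.
move=> ij; have ss := arc_size e; have si := ltn_ord i; have sj := ltn_ord j.
have [x [y [exy xy ex ey]]] := edge_ends e.
have tE s : touches (arc e)`_j s = (s == seg i) || (s == seg j).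
  apply/idP/orP => [ts|[]/eqP->]; last 2 first.
  - by rewrite /touches /dst /= ij eqxx orbT.
  - by rewrite /touches /src /= eqxx.
  have [es|es] := eqVneq (tag s) e.
    case: s es ts => e' k /= es; move: k; rewrite es => k.
    rewrite /touches /src /dst /= => /orP[]/eqP/arc_nth_inj ejk; [right|left];
      apply/eqP; congr existT; apply: val_inj => /=; have := ltn_ord k; move: ejk => /(_ _ _); lia.
  have [||v ve pv] := @arc_meet _ _ _ _ D _ _ (arc e)`_j es.
  - apply: on_seg_polyline; case/orP: ts => /eqP->.
      exact: on_segment_l.
    exact: on_segment_r.
  - by apply: (@on_seg_polyline (seg j)); apply: on_segment_l.
  rewrite inE in ve; case/andP: ve => _ /vertex_corner[l ls pl].
  by have := @arc_nth_inj e l j; rewrite pl pv => /(_ _ _ erefl); lia.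
rewrite (eq_bigl _ _ tE) (bigD1 (seg i)) ?eqxx //=; congr (op _ _).
have sij : seg j != seg i.
  by apply/eqP => /(congr1 (fun s : segment => nat_of_ord (tagged s))) /= e_ij; move: ij; rewrite e_ij; lia.
rewrite (big_pred1 (seg j)) // => s.
case: (eqVneq s (seg i)) => [->|_]; last by rewrite andbT.
by rewrite andbF /= eq_sym (negbTE sij).
Qed.
End SumOver.
End Drawing.

Lemma sum_edges (G : sgraph) (X : Type) (idx : X) (op : Monoid.com_law idx) (f : {set G} -> X) (v : G) :
  \big[op/idx]_(e : edge G | v \in val e) f (val e) = \big[op/idx]_(e in edges G | v \in e) f e.
Proof.
rewrite [RHS](reindex_omap (val : edge G -> {set G}) insub) /=.
  by apply: eq_bigl => e; rewrite (valP e) valK eqxx andbT.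
by move=> e /andP[eG _]; rewrite insubT.
Qed.

(** All segments of an arc inherit the weight of its edge.  Then the weights cancel
at the inner corners, where the same weight occurs twice, as well as at the
vertices, so [straight_face_labels] applies.  Evenness at the inner corners shows
that the boundary of [phi] contains all segments of an arc or none; so the label
of the first segment serves for the whole edge. *)
Lemma planar_face_labelled (R : realType) (G : sgraph) :
  planar R G -> face_labelled (edges G).
Proof.
move=> [pos [arc D]] W k char2 bal.
pose pts := flatten [seq arc e | e <- enum {: edge G}].
have arcP e i : (i < size (arc e))%N -> (arc e)`_i \in pts.
  by move=> si; apply/flatten_mapP; exists e; rewrite ?mem_enum // mem_nth.
have [lam Xinj] := generic_shear pts.
pose X (q : 'rV[R]_2) : R := q 0 0 + lam * q 0 1.
pose Y (q : 'rV[R]_2) : R := q 0 1.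
pose P : finType := seq_sub pts.
have ssz (s : segment arc) := seg_size D s.
pose sp (s : segment arc) : P := SeqSub (arcP _ _ (ltnW (ssz s))).
pose dp (s : segment arc) : P := SeqSub (arcP _ _ (ssz s)).
pose b (s : segment arc) : bool := X (src s) < X (dst s).
pose lp (s : segment arc) : P := if b s then sp s else dp s.
pose rp (s : segment arc) : P := if b s then dp s else sp s.
pose px (p : P) : R := X (val p); pose py (p : P) : R := Y (val p).
pose m (s : segment arc) : R := (py (rp s) - py (lp s)) / (px (rp s) - px (lp s)).
pose c (s : segment arc) : R := py (lp s) - m s * px (lp s).
have px_inj : injective px.
  by move=> p q pq; apply: val_inj; apply: Xinj; rewrite ?(valP p) ?(valP q).
have lr s : px (lp s) < px (rp s).
  have ne : px (sp s) != px (dp s).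
    apply/eqP => /px_inj/(congr1 val) /= /(arc_nth_inj D); have := ssz s; lia.
  rewrite /lp /rp; case bs: (b s); first exact: bs.
  by rewrite lt_neqAle eq_sym ne leNgt; apply/negbT; apply: bs.
have hl s : c s + m s * px (lp s) = py (lp s) by rewrite /c subrK.
have hr s : c s + m s * px (rp s) = py (rp s).
  rewrite /c /m; have : px (rp s) - px (lp s) != 0 by rewrite subr_eq0 gt_eqF.
  set u := px (rp s); set w := px (lp s) => h; field.
  exact: h.
have touchE (p : P) s : (p == lp s) || (p == rp s) = touches (val p) s.
  rewrite /touches /lp /rp -!(inj_eq val_inj); case: (b s) => //; exact: orbC.
have param s x : px (lp s) <= x <= px (rp s) ->
    exists q, [/\ on_segment (src s) (dst s) q, X q = x & Y q = c s + m s * x].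
  move=> xs; have h := lr s; pose t := (x - px (lp s)) / (px (rp s) - px (lp s)).
  have t01 : 0 <= t <= 1.
    by rewrite /t divr_ge0 ?ler_pdivrMr ?mul1r; lra.
  pose q := (1 - t) *: val (lp s) + t *: val (rp s); exists q.
  have h' : px (rp s) - px (lp s) != 0 by rewrite subr_eq0 gt_eqF.
  have Xq : X q = px (lp s) + t * (px (rp s) - px (lp s)).
    by rewrite /X /q /px /X !mxE; ring.
  have Yq : Y q = py (lp s) + t * (py (rp s) - py (lp s)).
    by rewrite /Y /q /py /Y !mxE; ring.
  have xE : px (lp s) + t * (px (rp s) - px (lp s)) = x.
    by rewrite /t divfK // addrC subrK.
  split.
  - have : on_segment (val (lp s)) (val (rp s)) q by exists t.
    by rewrite /lp /rp; case: (b s) => // /on_segment_sym.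
  - by rewrite Xq.
  - by rewrite Yq -[in RHS]xE /c /m; move: h'; set d := px (rp s) - _ => h'; field.
have noncross s t x : s != t -> px (lp s) <= x <= px (rp s) -> px (lp t) <= x <= px (rp t) ->
    c s + m s * x = c t + m t * x ->
    exists p, [/\ (p == lp s) || (p == rp s), (p == lp t) || (p == rp t) & px p = x].
  move=> st /param[q [qs Xq Yq]] /param[q' [qt Xq' Yq']] e.
  have qq : q' = q.
    have eY : q' 0 1 = q 0 1 by rewrite -[LHS]/(Y q') -[RHS]/(Y q) Yq' Yq e.
    have eX : q' 0 0 = q 0 0.
      have : q' 0 0 + lam * q' 0 1 = q 0 0 + lam * q 0 1 by rewrite -[LHS]/(X q') -[RHS]/(X q) Xq Xq'.
      by rewrite eY => /addIr.
    apply/rowP => -[[|[|//]] i].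
      by rewrite (_ : Ordinal i = 0) //; apply: val_inj.
    by rewrite (_ : Ordinal i = 1) //; apply: val_inj.
  rewrite qq in qt; have /andP[ts tt] := segments_meet D st qs qt.
  have qp : q \in pts.
    by case/orP: ts => /eqP->; apply: (arcP); rewrite ?ssz // ltnW.
  exists (SeqSub qp); split; [by rewrite touchE|by rewrite touchE|exact: Xq].
have k_bal (p : P) : \sum_(s | (p == lp s) || (p == rp s)) k (val (tag s)) = 0.
  rewrite (eq_bigl _ _ (touchE p)).
  have [e _ /(nthP 0)[i si pi]] := flatten_mapP (valP p).
  have vert v : val p = pos v -> \sum_(s : segment arc | touches (val p) s) k (val (tag s)) = 0.
    move=> ->; transitivity (\sum_(e : edge G | v \in val e) k (val e)).
      exact: (sum_at_vertex D +%R (fun e => k (val e)) v).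
    by rewrite sum_edges bal.
  have [x [y [_ _ ex ey]]] := edge_ends D e.
  have [i0|i0] := posnP i; first by apply: (vert x); rewrite -pi i0.
  have [i1|i1] := eqVneq i (size (arc e)).-1; first by apply: (vert y); rewrite -pi i1.
  have si' : (i < size (arc e))%N := si.
  have li : (i < (size (arc e)).-1)%N by lia.
  have lj : (i.-1 < (size (arc e)).-1)%N by lia.
  rewrite -pi (@sum_at_bend _ _ _ _ D _ _ +%R _ e (Ordinal lj) (Ordinal li)) /= ?char2 //.
  by rewrite prednK.
have [l lP] := straight_face_labels (StraightDrawing px_inj lr hl hr noncross) char2 k_bal.
(* Membership of the segment [s] in the boundary of [phi]. *)
pose g phi s := (phi == l s) (+) (phi == l s + k (val (tag s))).
have s0 e : (0 < (size (arc e)).-1)%N by have := arc_size D e; lia.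
have gE phi e (i : 'I_(size (arc e)).-1) : g phi (seg i) = g phi (seg (Ordinal (s0 e))).
  case: i => i; elim: i => [|i IH] si; first by congr (g phi (seg _)); apply: val_inj.
  have si' := ltnW si; rewrite -(IH si').
  have si2 : (i.+1 < size (arc e))%N by lia.
  have := lP phi (SeqSub (arcP e _ si2)); rewrite (eq_bigl _ _ (touchE _)) /=.
  rewrite (@sum_at_bend _ _ _ _ D _ _ addb (g phi) e (Ordinal si') (Ordinal si)) //.
  by case: (g _ _); case: (g _ _).
pose l' (e : {set G}) : W := if insub e is Some e' then l (seg (Ordinal (s0 e'))) else 0.
have l'E (e : edge G) : l' (val e) = l (seg (Ordinal (s0 e))) by rewrite /l' valK.
exists l' => phi v.
rewrite -(sum_edges addb (fun e => (phi == l' e) (+) (phi == l' e + k e))).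
have gl (e : edge G) :
    (phi == l' (val e)) (+) (phi == l' (val e) + k (val e)) = g phi (seg (Ordinal (s0 e))).
  by rewrite l'E.
rewrite (eq_bigr _ (fun e _ => gl e)).
transitivity (\big[addb/false]_(s : segment arc | touches (pos v) s) g phi (seg (Ordinal (s0 (tag s))))).
  exact/esym/(sum_at_vertex D addb (fun e => g phi (seg (Ordinal (s0 e))))).
have gs s : g phi (seg (Ordinal (s0 (tag s)))) = g phi s by case: s => e i; rewrite -(gE phi e i).
rewrite (eq_bigr _ (fun s _ => gs s)).
have [vp|vp] := boolP (pos v \in pts).
  by apply: etrans (lP phi (SeqSub vp)); apply: eq_bigl => s; rewrite touchE.
apply: big_pred0 => s; apply/negP => ts; case/negP: vp.
by case/orP: ts => /eqP->; apply: (arcP); rewrite ?ssz // ltnW.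
Qed.

End FaceLabels.

(** * Euler's inequality *)

Section EdgeSets.
Variables (V : finType).
Implicit Types (F A : {set {set V}}) (v x y : V).

Definition simple_edges F := forall e, e \in F -> #|e| = 2.
Definition star F v := [set e in F | v \in e].
Definition triangles F : {set {set V}} :=
  [set T : {set V} | (#|T| == 3) && [forall e : {set V}, (e \subset T) && (#|e| == 2) ==> (e \in F)]].

Lemma big_addb_odd (I : finType) (P b : pred I) :
  \big[addb/false]_(i | P i) b i = odd #|[set i | P i & b i]|.
Proof.
rewrite -sum1_card (big_morph odd oddD (erefl _)) /=.
rewrite [RHS](eq_bigl (fun i => P i && b i)); last by move=> i; rewrite inE.
by rewrite big_mkcondr; apply: eq_bigr => i _; case: (b i).
Qed.

Section SmallEven.
Variable A : {set {set V}}.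
Hypothesis simpleA : simple_edges A.
Hypothesis evenA : forall v, ~~ odd #|star A v|.

Lemma even_other_edge e v : e \in A -> v \in e -> exists2 w, w \notin e & [set v; w] \in A.
Proof.
move=> eA ve; have es : e \in star A v by rewrite inE eA.
have := evenA v; rewrite (cardsD1 e) es /= negbK => /odd_gt0.
rewrite card_gt0 => /set0Pn[f]; rewrite !inE => /and3P[fe fA vf].
have /cards2P[a [b [ab fab]]] : #|f| == 2 by rewrite simpleA.
have [w vw fE] : exists2 w, v != w & f = [set v; w].
  move: vf; rewrite fab !inE => /orP[]/eqP->; first by exists b.
  by exists a; rewrite 1?eq_sym // setUC.
exists w; rewrite -?fE //; apply: contra fe => we.
rewrite eqEcard fE subUset !sub1set ve we /=.
by rewrite (simpleA eA) cards2 vw.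
Qed.

(** Starting from an edge xy, evenness gives a second edge xz at x and a third edge
yw at y.  If there are no others, evenness at z forces w = z.  A triangle is then
recovered from its vertices, as the set of all pairs of them. *)
Lemma even_set_triangle : A != set0 ->
  3 <= #|A| /\ (#|A| = 3 -> #|cover A| = 3 /\ A = [set e : {set V} | e \subset cover A & #|e| == 2]).
Proof.
case/set0Pn => e eA.
have /cards2P[x [y [xy eE]]] : #|e| == 2 by rewrite simpleA.
have [|z ze xzA] := even_other_edge (v := x) eA; first by rewrite eE !inE eqxx.
have [|w we ywA] := even_other_edge (v := y) eA; first by rewrite eE !inE eqxx orbT.
move: ze we; rewrite eE !inE !negb_or => /andP[zx zy] /andP[wx wy].
set B := [set [set x; y]; [set x; z]; [set y; w]].
have BA : B \subset A by rewrite !subUset !sub1set -eE eA xzA.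
have mem_neq (f g : {set V}) a : a \in f -> a \notin g -> f != g.
  by move=> af; apply: contraNneq => <-.
have n1 : [set x; y] != [set x; z].
  by apply: (mem_neq _ _ y); rewrite !inE ?eqxx ?orbT // (eq_sym y) (negbTE xy) eq_sym (negbTE zy).
have n2 : [set x; y] != [set y; w].
  by apply: (mem_neq _ _ x); rewrite !inE ?eqxx // negb_or xy eq_sym.
have n3 : [set x; z] != [set y; w].
  by apply: (mem_neq _ _ x); rewrite !inE ?eqxx // negb_or xy eq_sym.
have cB : #|B| = 3.
  by rewrite /B setUC cardsU1 cards2 !inE n1 !(eq_sym [set y; w]) (negbTE n2) (negbTE n3).
split; first by rewrite -cB subset_leq_card.
move=> cA; have AB : A = B by apply/eqP; rewrite eq_sym eqEcard BA cA cB.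
have zw : z = w.
  have [|u] := even_other_edge (v := z) xzA; first by rewrite !inE eqxx orbT.
  rewrite !inE negb_or AB !inE => /andP[ux uz] uA.
  have zu : z \in [set z; u] by rewrite !inE eqxx.
  case/orP: uA => [/orP[]/eqP E|/eqP E]; move: zu; rewrite E !inE.
  - by rewrite (negbTE zx) (negbTE zy).
  - move=> _; have : u \in [set x; z] by rewrite -E !inE eqxx orbT.
    by rewrite !inE (negbTE ux) (negbTE uz).
  - by rewrite (negbTE zy) => /eqP.
have covA : cover A = [set x; y; z].
  rewrite AB /cover /B.
  rewrite bigcup_setU bigcup_setU !big_set1 -zw.
  by apply/setP => u; rewrite !inE; case: (u == x); case: (u == y); case: (u == z).
have c3 : #|[set x; y; z]| = 3.
  by rewrite setUC cardsU1 !inE negb_or zx zy cards2 xy.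
split; first by rewrite covA.
apply/eqP; rewrite eqEcard; apply/andP; split.
  apply/subsetP => f fA; rewrite inE (simpleA fA) eqxx andbT.
  exact: bigcup_sup fA.
by rewrite cards_draws covA c3 cA.
Qed.
End SmallEven.

Local Open Scope ring_scope.

Lemma F2_addrr (x : 'F_2) : x + x = 0.
Proof. by case: x => [[|[|//]] i]; apply: val_inj. Qed.

Lemma mx_F2_addrr m n (x : 'M['F_2]_(m, n)) : x + x = 0.
Proof. by apply/matrixP => i j; rewrite !mxE F2_addrr. Qed.

Lemma F2_addb (a b : bool) : (a (+) b)%:R = a%:R + b%:R :> 'F_2.
Proof. by case: a; case: b; apply: val_inj. Qed.

(** The weights are the rows of a cokernel [K] of the incidence matrix, so that they
cancel at each vertex.  [M] is the matrix with the boundaries [bd phi] as rows.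
Since the two side labels of an edge add up to its weight, K = M^T *m Pm, where
[Pm] lists all labels; hence the rank of [K], which is at least
#|F| - (#|cover F| - 1), is at most the number of distinct nonempty boundaries. *)
Lemma euler_inequality F : simple_edges F -> F != set0 -> face_labelled F ->
  (2 * #|F| + 4 <= 4 * #|cover F| + #|triangles F|)%N.
Proof.
move=> simpleF /set0Pn[e0 e0F] labF.
set n := #|F|; pose ev (j : 'I_n) : {set V} := enum_val j.
have evF j : ev j \in F by apply: enum_valP.
pose Inc := \matrix_(i < #|V|, j < n) ((enum_val i \in ev j)%:R : 'F_2).
pose K := cokermx Inc.
pose k e := if e \in F then row (enum_rank_in e0F e) K else 0.
have kev j : k (ev j) = row j K by rewrite /k evF enum_valK_in.
have bal v : \sum_(e in F | v \in e) k e = 0.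
  rewrite big_enum_val_cond /=.
  transitivity (row (enum_rank v) (Inc *m K)); last by rewrite mulmx_coker linear0.
  apply/rowP => i; rewrite summxE !mxE big_mkcond /=; apply: eq_bigr => j _.
  by rewrite !mxE enum_rankK -/(ev j) kev !mxE; case: (v \in ev j); rewrite ?mul1r ?mul0r.
have [l lP] := labF _ k (@mx_F2_addrr 1 n) bal.
pose bd phi := [set e in F | (phi == l e) (+) (phi == l e + k e)].
pose Fam := [set bd phi | phi : 'rV['F_2]_n] :\ set0.
have rkK : (\rank K <= #|Fam|)%N.
  pose M := \matrix_(i < #|'rV['F_2]_n|, j < n) ((ev j \in bd (enum_val i))%:R : 'F_2).
  pose Pm := \matrix_(i < #|'rV['F_2]_n|) (enum_val i : 'rV['F_2]_n).
  pose N := \matrix_(a < #|Fam|, j < n) ((ev j \in enum_val a)%:R : 'F_2).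
  have -> : K = M^T *m Pm.
    apply/row_matrixP => j; rewrite -kev [RHS]row_mul.
    rewrite mulmx_sum_row.
    transitivity (\sum_(phi : 'rV['F_2]_n) (ev j \in bd phi)%:R *: phi).
      rewrite (eq_bigr (fun phi => ((phi == l (ev j))%:R *: phi + (phi == l (ev j) + k (ev j))%:R *: phi))).
        have single (a : 'rV['F_2]_n) : \sum_phi (phi == a)%:R *: phi = a.
          rewrite (bigD1 a) //= eqxx scale1r big1 ?addr0 // => phi /negbTE ->.
          by rewrite scale0r.
        by rewrite big_split /= !single addrA mx_F2_addrr add0r.
      by move=> phi _; rewrite inE evF F2_addb scalerDl.
    rewrite (reindex_onto enum_val enum_rank) /=; last by move=> i _; rewrite enum_rankK.
    apply: eq_big => [i|i _]; first by rewrite enum_valK eqxx.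
    by rewrite rowK !mxE.
  rewrite (leq_trans (mxrankM_maxl _ _)) // mxrank_tr (leq_trans _ (rank_leq_row N)) //.
  apply: mxrankS; apply/row_subP => i.
  have [b0|b0] := eqVneq (bd (enum_val i)) set0.
    rewrite (_ : row i M = 0) ?sub0mx //.
    by apply/rowP => j; rewrite !mxE b0 inE.
  have bF : bd (enum_val i) \in Fam by rewrite inE in_set1 b0 imset_f.
  rewrite (_ : row i M = row (enum_rank_in bF (bd (enum_val i))) N) ?row_sub //.
  by apply/rowP => j; rewrite !mxE enum_rankK_in.
(* The rows of isolated vertices vanish, and all rows add up to zero. *)
have rkInc : (\rank Inc < #|cover F|)%N.
  have [v0 v0e] : exists v, v \in e0 by apply/card_gt0P; rewrite simpleF.
  have v0F : v0 \in cover F by apply/bigcupP; exists e0.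
  pose C := cover F :\ v0.
  rewrite (cardsD1 v0) v0F add1n ltnS -/C.
  pose N := \matrix_(a < #|C|, j < n) ((enum_val a \in ev j)%:R : 'F_2).
  rewrite (leq_trans _ (rank_leq_row N)) //; apply: mxrankS; apply/row_subP => i.
  have inC v (vC : v \in C) : \row_j (v \in ev j)%:R = row (enum_rank_in vC v) N.
    by apply/rowP => j; rewrite !mxE enum_rankK_in.
  have rowE : row i Inc = \row_j (enum_val i \in ev j)%:R by apply/rowP => j; rewrite !mxE.
  rewrite rowE; move: (enum_val i) => v {rowE i}.
  have [->|vv0] := eqVneq v v0; last first.
    have [vF|vF] := boolP (v \in cover F).
      have vC : v \in C by rewrite !inE vv0.
      by rewrite (inC _ vC) row_sub.
    rewrite (_ : \row_j _ = 0) ?sub0mx //; apply/rowP => j; rewrite !mxE.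
    case vj: (v \in ev j) => //; case/negP: vF; apply/bigcupP.
    by exists (ev j).
  have -> : \row_j (v0 \in ev j)%:R = \sum_(a < #|C|) row a N.
    apply/rowP => j; rewrite summxE mxE.
    have -> : \sum_(a < #|C|) row a N 0 j = \sum_(u in C) (u \in ev j)%:R.
      by rewrite [RHS]big_enum_val; apply: eq_bigr => a _; rewrite !mxE.
    have sub u : u \in ev j -> u \in cover F by move=> uj; apply/bigcupP; exists (ev j).
    have : (v0 \in ev j)%:R + \sum_(u in C) (u \in ev j)%:R = 0 :> 'F_2.
      transitivity (\sum_(u in cover F) (u \in ev j)%:R : 'F_2).
        by rewrite [RHS](big_setD1 v0).
      have -> : \sum_(u in cover F) (u \in ev j)%:R = \sum_(u in ev j) 1 :> 'F_2.
        rewrite [RHS]big_mkcond [LHS]big_mkcond; apply: eq_bigr => u _.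
        case uj: (u \in ev j); first by rewrite sub.
        by case: ifP.
      by rewrite sumr_const simpleF // -[1 *+ 2]/(1 + 1) F2_addrr.
    by move/(congr1 (+%R ((v0 \in ev j)%:R))); rewrite addrA F2_addrr add0r addr0.
  by apply: summx_sub => a _; apply: row_sub.
have FamP A : A \in Fam -> [/\ A != set0, A \subset F, simple_edges A & forall v, ~~ odd #|star A v|].
  rewrite in_setD1 => /andP[A0 /imsetP[phi _ AE]].
  have AF : A \subset F by rewrite AE; apply/subsetP => e; rewrite inE => /andP[].
  split=> // [e /(subsetP AF) /simpleF //|v].
  apply/negPf; rewrite -[RHS](lP phi v) big_addb_odd; congr (odd _); apply: eq_card => e.
  by rewrite AE !inE -!andbA; do !bool_congr.
have card3 : (#|[set A in Fam | #|A| == 3]| <= #|triangles F|)%N.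
  rewrite -(card_in_imset (f := @cover V)).
    apply: subset_leq_card; apply/subsetP => T /imsetP[A]; rewrite inE => /andP[AFam /eqP A3] ->.
    have [A0 AF sA eA] := FamP _ AFam.
    have [_ /(_ A3)[c3 AE]] := even_set_triangle sA eA A0.
    rewrite inE c3 eqxx; apply/forallP => e; apply/implyP => eT.
    by apply: (subsetP AF); rewrite AE inE.
  move=> A B; rewrite !inE => /andP[AFam /eqP A3] /andP[BFam /eqP B3] AB.
  have AF : A \in Fam by rewrite !inE. have BF : B \in Fam by rewrite !inE.
  have [A0 _ sA eA] := FamP _ AF; have [B0 _ sB eB] := FamP _ BF.
  have [_ /(_ A3)[_ ->]] := even_set_triangle sA eA A0.
  have [_ /(_ B3)[_ BE]] := even_set_triangle sB eB B0.
  by rewrite [in RHS]BE AB.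
(* An edge lies in the boundaries of its two side labels only. *)
have sum2 : (\sum_(A in Fam) #|A| <= 2 * n)%N.
  have -> : (\sum_(A in Fam) #|A| = \sum_(e in F) #|[set A in Fam | e \in A]|)%N.
    under eq_bigr do rewrite -sum1_card.
    rewrite (exchange_big_dep (mem F)) /=; last first.
      by move=> A e /FamP[_ /subsetP AF _ _] /AF.
    by apply: eq_bigr => e eF; rewrite -sum1_card; apply: eq_bigl => A; rewrite inE.
  rewrite mulnC -sum_nat_const; apply: leq_sum => e eF.
  apply: leq_trans (_ : #|[set bd (l e); bd (l e + k e)%R]| <= 2)%N.
    apply: subset_leq_card; apply/subsetP => A; rewrite !inE => /andP[/andP[_ /imsetP[phi _ ->]]].
    rewrite inE eF /=; case: eqP => [->|_]; first by rewrite eqxx.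
    by case: eqP => [->|//]; rewrite eqxx orbT.
  by rewrite cards2; case: (_ != _).
have sum4 : (4 * #|Fam| <= \sum_(A in Fam) #|A| + #|triangles F|)%N.
  apply: leq_trans (leq_add (leqnn _) card3).
  rewrite mulnC -sum_nat_const -[X in (_ <= _ + X)%N]sum1_card.
  rewrite [X in (_ <= _ + X)%N](eq_bigl (fun A => (A \in Fam) && (#|A| == 3)%N)); last first.
    by move=> A; rewrite !inE.
  rewrite big_mkcondr -big_split /=; apply: leq_sum => A AFam.
  have [A0 AF sA eA] := FamP _ AFam.
  by have [ge3 _] := even_set_triangle sA eA A0;
    case: eqP => [->//|/eqP c]; rewrite addn0 ltn_neqAle eq_sym c.
by move: rkK; rewrite /K mxrank_coker -/n; lia.
Qed.
End EdgeSets.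

(** * Discharging *)

Section Structure.
Variables (V : finType) (F : {set {set V}}).
Implicit Types (e T : {set V}) (u v x y : V).

Definition deg v := #|star F v|.
Definition nbrs v := [set u | (u != v) && ([set v; u] \in F)].

Hypothesis simpleF : simple_edges F.

Lemma nbrs_sym u v : (u \in nbrs v) = (v \in nbrs u).
Proof. by rewrite !inE eq_sym setUC. Qed.

Lemma card_nbrs v : #|nbrs v| = deg v.
Proof.
rewrite /deg -(@card_in_imset _ _ (fun u => [set v; u]) (nbrs v)).
  apply: eq_card => e; rewrite !inE; apply/imsetP/andP => [[u]|[eF ve]].
    by rewrite inE => /andP[_ uF] ->; rewrite !inE eqxx.
  have /cards2P[a [b [ab eE]]] : #|e| == 2 by rewrite simpleF.
  move: ve; rewrite eE !inE => /orP[]/eqP va.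
    by exists b; rewrite ?inE va // -eE eF eq_sym ab.
  by exists a; rewrite ?inE va 1?setUC // -eE eF ab.
move=> x y; rewrite !inE => /andP[xv _] /andP[yv _] /setP/(_ x).
by rewrite !inE eqxx (negbTE xv) orbT => /esym/eqP.
Qed.

Lemma sum_deg : \sum_v deg v = 2 * #|F|.
Proof.
transitivity (\sum_(e in F) #|e|).
  under eq_bigr do rewrite /deg -sum1_card.
  rewrite (exchange_big_dep (mem F)) /=; last by move=> v e _; rewrite inE => /andP[].
  apply: eq_bigr => e eF; rewrite -sum1_card; apply: eq_bigl => v.
  by rewrite inE eF.
by rewrite (eq_bigr (fun=> 2)) // sum_nat_const mulnC.
Qed.

Lemma triangle_edge T x y : T \in triangles F -> x \in T -> y \in T -> x != y -> [set x; y] \in F.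
Proof.
rewrite inE => /andP[_ /forallP/(_ [set x; y])/implyP TF] xT yT xy; apply: TF.
by rewrite subUset !sub1set xT yT cards2 xy.
Qed.

Lemma triangle_card T : T \in triangles F -> #|T| = 3.
Proof. by rewrite inE => /andP[/eqP]. Qed.

Definition tri v := #|[set T in triangles F | v \in T]|.

Hypothesis kitelessF : forall T T' e, T \in triangles F -> T' \in triangles F ->
  e \in F -> e \subset T -> e \subset T' -> T = T'.

(** Distinct triangles at [v] share no other vertex, since they would share the edge
that joins it to [v]. *)
Lemma triangles_disjoint_at v (P : {set V}) :
  \sum_(T in triangles F | v \in T) #|(T :\ v) :&: P| <= #|P|.
Proof.
under eq_bigr do rewrite -sum1_card.
rewrite (exchange_big_dep (mem P)) /=; last by move=> T x _; rewrite !inE => /andP[].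
rewrite -[leqRHS]sum1_card; apply: leq_sum => x xP.
rewrite sum1dep_card; apply/card_le1_eqP => T T'; rewrite !(in_set, in_set1) xP !andbT.
move=> /andP[/andP[TF vT] /andP[xv xT]] /andP[/andP[TF' vT'] /andP[_ xT']].
have TF1 : T \in triangles F by rewrite inE.
have TF1' : T' \in triangles F by rewrite inE.
apply: esym; apply: (kitelessF TF1 TF1' (triangle_edge TF1 vT xT _)); first by rewrite eq_sym.
  by rewrite subUset !sub1set vT.
by rewrite subUset !sub1set vT'.
Qed.

Lemma tri_sum v (f : {set V} -> nat) (c : nat) : 
  (forall T, T \in triangles F -> v \in T -> c <= f T) ->
  c * tri v <= \sum_(T in triangles F | v \in T) f T.
Proof.
move=> cf; rewrite mulnC -sum_nat_const.
rewrite (eq_bigl (fun T => (T \in triangles F) && (v \in T))); last by move=> T; rewrite inE.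
by apply: leq_sum => T /andP[]; apply: cf.
Qed.

Lemma triangle_sub_nbrs T v : T \in triangles F -> v \in T -> T :\ v \subset nbrs v.
Proof.
move=> TF vT; apply/subsetP => x; rewrite !inE => /andP[xv xT].
by rewrite xv (triangle_edge TF) // eq_sym.
Qed.

Lemma tri_deg v : 2 * tri v <= deg v.
Proof.
rewrite -card_nbrs; apply: leq_trans (triangles_disjoint_at v _).
apply: tri_sum => T TF vT; rewrite (setIidPl (triangle_sub_nbrs TF vT)).
by have := cardsD1 v T; rewrite (triangle_card TF) vT add1n => -[<-].
Qed.

Variable k : nat.
Hypothesis k9 : 9 <= k.
Hypothesis degk : forall v, deg v <= k.
Hypothesis heavyF : forall u v, u \in nbrs v -> deg u <= 4 -> k + 2 <= deg u + deg v.

Definition small v := #|[set u in nbrs v | deg u <= 3]|.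

(** Of the two other vertices of a triangle at [v] at most one is small, and
different triangles yield different neighbours of [v] that are not small. *)
Lemma tri_small v : tri v + small v <= deg v.
Proof.
rewrite -card_nbrs addnC -(cardsID [set u | deg u <= 3] (nbrs v)).
have -> : small v = #|nbrs v :&: [set u | deg u <= 3]|.
  by apply: eq_card => u; rewrite !inE.
rewrite leq_add2l; apply: leq_trans (triangles_disjoint_at v _).
rewrite -[tri v]mul1n; apply: tri_sum => T TF vT.
have /cards2P[x [y [xy TE]]] : #|T :\ v| == 2.
  by have := cardsD1 v T; rewrite (triangle_card TF) vT add1n => -[<-].
have /subsetP sub := triangle_sub_nbrs TF vT.
have xT : x \in T :\ v by rewrite TE !inE eqxx.
have yT : y \in T :\ v by rewrite TE !inE eqxx orbT.
have xy_nb : x \in nbrs y.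
  move: xT yT; rewrite !inE => /andP[_ xT] /andP[_ yT].
  by rewrite xy (triangle_edge TF) // eq_sym.
rewrite card_gt0; apply/set0Pn; have [x3|x3] := leqP (deg x) 3.
  exists y; rewrite inE yT !inE -ltnNge; have := sub _ yT; rewrite !inE => ->; rewrite andbT.
  have := heavyF xy_nb; lia.
by exists x; rewrite inE xT !inE -ltnNge x3; have := sub _ xT; rewrite !inE => ->.
Qed.

Lemma small_deg v : 0 < small v -> k <= (deg v).+1.
Proof.
rewrite card_gt0 => /set0Pn[u]; rewrite inE => /andP[uv u3].
by have := heavyF uv; lia.
Qed.

(** What a vertex gives to each triangle at it, in units of 1/6.  It depends only on
the degree: two of the vertices of a triangle with a vertex of degree at most 4
have degree at least 7. *)
Definition weight v := if deg v <= 4 then 0 else if deg v <= 6 then 2 else 3.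

Lemma triangle_weight T : T \in triangles F -> 6 <= \sum_(v in T) weight v.
Proof.
move=> TF.
have [/existsP[x /andP[xT x4]]|/existsPn no4] := boolP [exists x, (x \in T) && (deg x <= 4)].
  rewrite (big_setD1 x) //= [X in _ <= _ + X](eq_bigr (fun=> 3)).
    rewrite sum_nat_const; have := cardsD1 x T; rewrite (triangle_card TF) xT add1n => -[<-].
    by rewrite leq_addl.
  move=> y /(subsetP (triangle_sub_nbrs TF xT)); rewrite nbrs_sym => xy.
  have h := heavyF xy x4; rewrite /weight; case: leqP => ?; [lia|by case: leqP => ?; lia].
apply: (@leq_trans (\sum_(v in T) 2)); first by rewrite sum_nat_const (triangle_card TF).
apply: leq_sum => v vT; have := no4 v; rewrite vT /weight /= => /negbTE ->.
by case: ifP.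
Qed.

Lemma sum_tri_weight : 6 * #|triangles F| <= \sum_v tri v * weight v.
Proof.
apply: (@leq_trans (\sum_(T in triangles F) \sum_(v in T) weight v)).
  by rewrite mulnC -sum_nat_const; apply: leq_sum => T; apply: triangle_weight.
rewrite (exchange_big_dep predT) //=; apply: leq_sum => v _.
rewrite sum_nat_const leq_mul // /tri; apply: subset_leq_card.
by apply/subsetP => T; rewrite inE.
Qed.

(** Each vertex of degree at most 3 is counted once by each of its neighbours. *)
Lemma sum_small : \sum_v small v = \sum_(u | deg u <= 3) deg u.
Proof.
under eq_bigr do rewrite /small -sum1_card.
rewrite (exchange_big_dep (fun u => deg u <= 3)) /=; last by move=> v u _; rewrite inE => /andP[].
apply: eq_bigr => u u3; rewrite -card_nbrs -sum1_card; apply: eq_bigl => v.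
by rewrite inE u3 andbT nbrs_sym.
Qed.

Hypothesis F0 : F != set0.
Hypothesis labF : face_labelled F.

Lemma deg_neq1 v : deg v != 1.
Proof.
apply/eqP => d1; have : 0 < #|nbrs v| by rewrite card_nbrs d1.
rewrite card_gt0 => /set0Pn[u]; rewrite nbrs_sym => vu.
by have := heavyF vu; have := degk u; lia.
Qed.

(** The balance of a vertex, in units of 1/6, with its gifts on the left and its
receipts on the right: 8 units into the pot from degree k; 8 from the pot and 2
from each neighbour for degree 2; 2 from each neighbour for degree 3.  The
initial charge is split into 6 deg v on the right and 24 on the left.  The case
deg v = k = 9 with four triangles and five neighbours of degree at most 3 is
tight. *)
Lemma discharge_vertex v :
  24 * (0 < deg v) + tri v * weight v + 2 * small v + 8 * (deg v == k) <=
  6 * deg v + 12 * (deg v == 2) + 6 * (deg v == 3).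
Proof.
have := tri_deg v; have := tri_small v; have := deg_neq1 v; have := degk v.
have : (small v == 0) || (k <= (deg v).+1).
  by case: posnP => //= /small_deg.
rewrite /weight; move: (tri v) (small v) (deg v) => t s d sk dk d1 ts td.
case: (leqP d 4) => d4; first by move: d sk dk d1 ts td d4 => [|[|[|[|[|d]]]]]; lia.
have -> : (0 < d) = true by lia.
by case: (leqP d 6) => d6; case: (d =P k) sk => dk' /orP[/eqP->|sk]; lia.
Qed.

Lemma many_deg2 : #|[set v | deg v == k]| < #|[set v | deg v == 2]|.
Proof.
rewrite ltnNge; apply/negP => n2k.
have euler := euler_inequality simpleF F0 labF.
have cov : #|cover F| = \sum_v (0 < deg v).
  rewrite -sum1_card big_mkcond; apply: eq_bigr => v _; rewrite card_gt0.
  suff -> : (v \in cover F) = (star F v != set0) by case: (_ != _).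
  apply/bigcupP/set0Pn => [[e eF ve]|[e]]; first by exists e; rewrite inE eF.
  by rewrite inE => /andP[eF ve]; exists e.
have ind (P : pred V) : #|[set v | P v]| = \sum_v P v.
  rewrite -sum1_card big_mkcond; apply: eq_bigr => v _.
  by rewrite inE; case: (P v).
have small_sum : \sum_v small v = 2 * #|[set v | deg v == 2]| + 3 * #|[set v | deg v == 3]|.
  rewrite sum_small big_mkcond !ind !big_distrr -big_split; apply: eq_bigr => v _ /=.
  by have := deg_neq1 v; case: (deg v) => [|[|[|[|d]]]].
have tw := sum_tri_weight.
have total : 24 * #|cover F| + \sum_v tri v * weight v + 2 * (\sum_v small v) +
    8 * #|[set v | deg v == k]| <=
    6 * (\sum_v deg v) + 12 * #|[set v | deg v == 2]| + 6 * #|[set v | deg v == 3]|.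
  rewrite cov !ind !big_distrr -!big_split /=; apply: leq_sum => v _.
  exact: discharge_vertex.
by move: total euler; rewrite sum_deg small_sum; move: n2k tw; lia.
Qed.
End Structure.

(** * Even cycles are 2-choosable *)

Section EvenCycle.
Variables (C : eqType) (D : finType).

(** The default [c] is never returned for a list of two distinct colours. *)
Definition other_color (s : seq C) (c : C) := head c [seq x <- s | x != c].

Lemma other_colorP s c : uniq s -> 1 < size s -> other_color s c \in s /\ other_color s c != c.
Proof.
move=> us ss; have : [seq x <- s | x != c] != [::].
  rewrite -size_eq0 -lt0n size_filter -has_count; apply/hasPn => no.
  have : size s <= size [:: c] by apply: uniq_leq_size => // x /no; rewrite negbK inE.
  by rewrite /=; lia.
rewrite /other_color; case E: [seq x <- s | x != c] => [//|b t] _ /=.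
have : b \in [seq x <- s | x != c] by rewrite E inE eqxx.
by rewrite mem_filter => /andP[].
Qed.

Variable Q : D -> seq C.
Hypothesis Q_uniq : forall x, uniq (Q x).
Hypothesis Q_size : forall x, 1 < size (Q x).

Section Orbit.
Variables (a b : D -> D).
Hypotheses (aK : involutive a) (bK : involutive b).
Hypotheses (a_free : forall x, a x != x) (b_free : forall x, b x != x).

Let g x := b (a x).

Lemma turn_inj : injective g.
Proof. exact: inj_comp (inv_inj bK) (inv_inj aK). Qed.

(** In a dihedral group without fixed points no reflection acts like a rotation:
from [iter n g x = a x] one gets [iter (n - 2) g (g x) = a (g x)], and finally a
fixed point of [a] or [b].  So the cycle through [x], on which [a] and [b]
alternate, is even: its edges are the [iter i g x] and their images under [a]. *)
Lemma iter_turn_reflect n x : iter n g x != a x.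
Proof.
have [m] := ubnP n; elim: m n x => // m IH [|[|n]] x nm; first by rewrite /= eq_sym.
  by rewrite /= /g b_free.
rewrite iterS; apply/eqP => e; have /eqP[] := IH n (g x) (ltnW nm).
by rewrite -iterSr; apply: (inv_inj aK); apply: (inv_inj bK); rewrite -/(g _) e aK bK.
Qed.

Lemma turn_reflect x y : fconnect g x y -> ~~ fconnect g x (a y).
Proof.
move=> xy; apply/negP => xay; have : fconnect g y (a y).
  by apply: connect_trans xay; rewrite fconnect_sym //; apply: turn_inj.
by move=> /iter_findex/eqP; apply/negP/iter_turn_reflect.
Qed.

Definition cycle_of x := [set y | fconnect g x y || fconnect g x (a y)].

Lemma cycle_of_id x : x \in cycle_of x.
Proof. by rewrite inE connect0. Qed.

Lemma cycle_of_a x y : y \in cycle_of x -> a y \in cycle_of x.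
Proof. by rewrite !inE aK orbC. Qed.

Lemma cycle_of_b x y : y \in cycle_of x -> b y \in cycle_of x.
Proof.
have step z : fconnect g x z = fconnect g x (g z) := same_fconnect1_r turn_inj x z.
by rewrite !inE (step (a (b y))) (step (a y)) /g !aK bK orbC.
Qed.

Lemma cycle_ofP x y : y \in cycle_of x -> 
  exists2 i, i < order g x & y = iter i g x \/ y = a (iter i g x).
Proof.
rewrite inE => /orP[] h.
  by exists (findex g x y); [apply: findex_max|left; rewrite iter_findex].
exists (findex g x (a y)); [exact: findex_max|right; by rewrite iter_findex // aK].
Qed.

Definition proper_at (c : D -> C) x := [&& c x \in Q x, c x != c (a x) & c x != c (b x)].

Lemma proper_on_cycle x c :
  (forall y, y \in cycle_of x -> c y \in Q y) ->
  (forall i, i < order g x -> c (iter i g x) != c (a (iter i g x))) ->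
  (forall i, i < order g x -> c (iter i g x) != c (b (iter i g x))) ->
  forall y, y \in cycle_of x -> proper_at c y.
Proof.
move=> cQ ca cb y yx; rewrite /proper_at cQ //=.
have [i ix [->|->]] := cycle_ofP yx; first by rewrite ca // cb.
rewrite aK eq_sym ca //= -[b (a _)]/(g _) eq_sym.
have gi : g (iter i g x) = iter (i.+1 %% order g x) g x.
  have [lt|ge] := ltnP i.+1 (order g x); first by rewrite modn_small.
  have -> : i.+1 = order g x by apply/eqP; rewrite eqn_leq ge ix.
  have e : i.+1 = order g x by apply/eqP; rewrite eqn_leq ge ix.
  by rewrite modnn -iterS e (iter_order turn_inj).
have := cb (i.+1 %% order g x); rewrite -gi ltn_mod order_gt0 => /(_ isT).
by rewrite /g bK.
Qed.

(** Give [x] a colour that its predecessor [b x] cannot use, and go around the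
cycle greedily: closing it up at [b x] causes no conflict. *)
Lemma color_cycle_break x col : col \in Q x -> col \notin Q (b x) ->
  exists c : D -> C, forall y, y \in cycle_of x -> proper_at c y.
Proof.
move=> colx colbx.
pose step i p := let p' := other_color (Q (a (iter i g x))) p in other_color (Q (iter i.+1 g x)) p'.
pose colE := fix colE i := if i is j.+1 then step j (colE j) else col.
pose colF i := other_color (Q (a (iter i g x))) (colE i).
pose c y := if fconnect g x y then colE (findex g x y) else colF (findex g x (a y)).
have cE i : i < order g x -> c (iter i g x) = colE i.
  by move=> ix; rewrite /c fconnect_iter findex_iter.
have cF i : i < order g x -> c (a (iter i g x)) = colF i.
  move=> ix; rewrite /c aK findex_iter //.
  by rewrite (negbTE (turn_reflect _)) // fconnect_iter.
have FP i : colF i \in Q (a (iter i g x)) /\ colF i != colE i by apply: other_colorP.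
exists c; apply: proper_on_cycle.
- move=> y /cycle_ofP[i ix [->|->]]; last by rewrite cF //; case: (FP i).
  rewrite cE //; case: i {ix} => [//|i].
  by have [] := @other_colorP (Q (iter i.+1 g x)) (colF i) (Q_uniq _) (Q_size _).
- by move=> i ix; rewrite cE // cF // eq_sym; case: (FP i).
- move=> [|i] ix.
    rewrite cE //.
    have e : b x = a (iter (order g x).-1 g x).
      apply: (inv_inj bK); rewrite -/(g _) -iterS prednK ?order_gt0 //.
      by rewrite (iter_order turn_inj) bK.
    rewrite /= e cF ?ltn_predL ?order_gt0 // -/(colF _).
    apply: contraNneq colbx => ->; rewrite e.
    by case: (FP (order g x).-1).
  rewrite cE //= /g bK cF; last exact: ltnW.
  by have [] := @other_colorP (Q (iter i.+1 g x)) (colF i) (Q_uniq _) (Q_size _).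
Qed.

(** If no colour is lost along the cycle, two colours of one list are in all lists
and can alternate. *)
Lemma color_cycle_const x :
  (forall y, y \in cycle_of x -> {subset Q y <= Q (a y)} /\ {subset Q y <= Q (b y)}) ->
  exists c : D -> C, forall y, y \in cycle_of x -> proper_at c y.
Proof.
move=> sub; case E: (Q x) (Q_size x) (Q_uniq x) => [|p [|q s]] // _ /=.
rewrite inE negb_or => /andP[/andP[pq _] _].
have QxE i : {subset Q x <= Q (iter i g x)}.
  elim: i => [//|i IH] z /IH zi.
  have yi : iter i g x \in cycle_of x by rewrite inE fconnect_iter.
  have [sa _] := sub _ yi; have [_ sb] := sub _ (cycle_of_a yi).
  exact/sb/sa.
have px : p \in Q x by rewrite E inE eqxx.
have qx : q \in Q x by rewrite E !inE eqxx orbT.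
pose c y := if fconnect g x y then p else q.
have cE i : c (iter i g x) = p by rewrite /c fconnect_iter.
have cF i : c (a (iter i g x)) = q.
  by rewrite /c (negbTE (turn_reflect _)) // fconnect_iter.
exists c; apply: proper_on_cycle.
- move=> y yx; have [i ix [->|->]] := cycle_ofP yx.
    by rewrite cE; apply: QxE.
  have yi : iter i g x \in cycle_of x by rewrite inE fconnect_iter.
  by rewrite cF; have [sa _] := sub _ yi; apply/sa/QxE.
- by move=> i _; rewrite cE cF.
- move=> i ix; rewrite cE.
  have bi : b (iter i g x) \in cycle_of x by apply: cycle_of_b; rewrite inE fconnect_iter.
  suff -> : c (b (iter i g x)) = q by [].
  rewrite /c ifF //; apply/negbTE.
  have -> : b (iter i g x) = a (a (b (iter i g x))) by rewrite aK.
  apply: turn_reflect; rewrite (same_fconnect1_r turn_inj) /g aK bK.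
  exact: fconnect_iter.
Qed.
End Orbit.

Variables (a b : D -> D).
Hypotheses (aK : involutive a) (bK : involutive b).
Hypotheses (a_free : forall x, a x != x) (b_free : forall x, b x != x).

(** By induction on a set [A] closed under both involutions: remove a cycle through
an element whose list has a colour missing from an adjacent list, if there is
one, and any cycle of [A] otherwise. *)
Lemma involutions_choosable : exists c : D -> C, forall x, proper_at a b c x.
Proof.
suff H (A : {set D}) : (forall x, x \in A -> a x \in A) -> (forall x, x \in A -> b x \in A) ->
    (A != set0) -> exists c : D -> C, forall x, x \in A -> proper_at a b c x.
  have [/eqP|D0] := boolP ([set: D] == set0); last first.
    have [||//|c cP] := H [set: D]; try by move=> x _; rewrite inE.
    by exists c => x; apply: cP; rewrite inE.
  move=> D0; have noD (x : D) : False by have := in_setT x; rewrite D0 inE.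
  by exists (fun x => False_rect C (noD x)) => x; case: (noD x).
have [m] := ubnP #|A|; elim: m A => // m IH A Am Aa Ab /set0Pn[x0 x0A].
have [O [x [c [xA xO Oa Ob cP]]]] : exists (O : {set D}) x (c : D -> C), [/\ x \in A, x \in O, 
    forall y, y \in O -> a y \in O, forall y, y \in O -> b y \in O &
    forall y, y \in O -> proper_at a b c y].
  have [/exists_inP[x xA /orP[]/allPn[p px pn]]|noBreak] :=
    boolP [exists x in A, ~~ all (mem (Q (a x))) (Q x) || ~~ all (mem (Q (b x))) (Q x)].
  - have [c cP] := color_cycle_break bK aK b_free a_free px pn.
    exists (cycle_of b a x), x, c; split=> //; first exact: cycle_of_id.
    + exact: cycle_of_b.
    + exact: cycle_of_a.
    + by move=> y /cP /and3P[c1 c2 c3]; apply/and3P.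
  - have [c cP] := color_cycle_break aK bK a_free b_free px pn.
    exists (cycle_of a b x), x, c; split=> //; first exact: cycle_of_id.
    + exact: cycle_of_a.
    + exact: cycle_of_b.
  - have sub y : y \in A -> {subset Q y <= Q (a y)} /\ {subset Q y <= Q (b y)}.
      move=> yA; move/exists_inPn: noBreak => /(_ y yA); rewrite negb_or !negbK.
      by case/andP => /allP h1 /allP h2.
    have cA y : y \in cycle_of a b x0 -> y \in A.
      case/(cycle_ofP aK) => i _.
      have iA : iter i (fun x => b (a x)) x0 \in A by elim: i => //= i IHi; apply/Ab/Aa.
      by case=> ->; last apply: Aa.
    have [c cP] := color_cycle_const aK bK a_free b_free (fun y h => sub y (cA y h)).
    exists (cycle_of a b x0), x0, c; split=> //; first exact: cycle_of_id.
    + exact: cycle_of_a.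
    + exact: cycle_of_b.
have Oai y : (a y \in O) = (y \in O) by apply/idP/idP => /Oa; rewrite ?aK.
have Obi y : (b y \in O) = (y \in O) by apply/idP/idP => /Ob; rewrite ?bK.
have [AO|AO] := eqVneq (A :\: O) set0.
  exists c => y yA; apply: cP; apply/negPn/negP => yO.
  by have := in_set0 y; rewrite -AO inE yO yA.
have [||||c' cP'] := IH (A :\: O) => //.
- rewrite -ltnS (leq_trans _ Am) // ltnS; apply: proper_card; apply/properP; split.
    exact: subsetDl.
  by exists x; rewrite // inE xO.
- by move=> y; rewrite !inE Oai => /andP[-> /Aa].
- by move=> y; rewrite !inE Obi => /andP[-> /Ab].
exists (fun y => if y \in O then c y else c' y) => y yA.
rewrite /proper_at Oai Obi; case: ifP => yO; first exact: cP.
by apply: cP'; rewrite inE yO.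
Qed.
End EvenCycle.

Lemma fiber_involution (D : finType) (I : eqType) (p : D -> I) :
  (forall x, #|[set y | p y == p x]| = 2) ->
  exists a : D -> D, [/\ involutive a, forall x, a x != x &
    forall x y, p x = p y -> x != y -> y = a x].
Proof.
move=> fib.
have ex x : exists y, [set z | p z == p x] :\ x = [set y].
  apply/cards1P; have := cardsD1 x [set z | p z == p x].
  by rewrite fib inE eqxx add1n => -[<-].
have [a aP] := fin_all_exists ex.
have mem x y : (y == a x) = (y != x) && (p y == p x).
  by move/setP/(_ y): (aP x); rewrite !inE => <-.
have ap x : (a x != x) && (p (a x) == p x) by rewrite -mem.
exists a; split.
- by move=> x; apply/esym/eqP; rewrite mem; have /andP[ax /eqP ->] := ap x; rewrite eq_sym ax eqxx.
- by move=> x; have /andP[] := ap x.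
- by move=> x y pxy xy; apply/eqP; rewrite mem eq_sym xy pxy eqxx.
Qed.

(** The elements of [D] are the edges of a 2-regular bipartite multigraph, and [p]
and [q] are their ends on the two sides. *)
Lemma two_regular_choosable (C : eqType) (D : finType) (I J : eqType) (p : D -> I) (q : D -> J)
    (Q : D -> seq C) :
  (forall x, #|[set y | p y == p x]| = 2) -> (forall x, #|[set y | q y == q x]| = 2) ->
  (forall x, uniq (Q x)) -> (forall x, 1 < size (Q x)) ->
  exists2 c : D -> C, forall x, c x \in Q x &
    forall x y, x != y -> p x = p y \/ q x = q y -> c x != c y.
Proof.
move=> fp fq uQ sQ; have [a [aK a_free aP]] := fiber_involution fp.
have [b [bK b_free bP]] := fiber_involution fq.
have [c cP] := involutions_choosable uQ sQ aK bK a_free b_free.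
exists c; first by move=> x; have /and3P[] := cP x.
move=> x y xy [pxy|qxy]; have /and3P[_ ca cb] := cP x.
  by rewrite (aP _ _ pxy xy).
by rewrite (bP _ _ qxy xy).
Qed.

(** * Reducible configurations *)

Section Alternator.
Variables (V : finType) (F : {set {set V}}) (k : nat).
Hypothesis simpleF : simple_edges F.
Local Notation deg := (deg F).
Local Notation nbrs := (nbrs F).
Hypothesis nbr2 : forall u v, deg u = 2 -> v \in nbrs u -> deg v = k.

Definition reach (X : {set V}) := [set y | [exists x in X, y \in nbrs x]].

Lemma reachP (X : {set V}) y : reflect (exists2 x, x \in X & y \in nbrs x) (y \in reach X).
Proof. by rewrite inE; apply: exists_inP. Qed.

(** Take [X] minimal among the nonempty sets of degree-2 vertices with at most #|X|
neighbours.  Removing any element must destroy the inequality, so [X] has exactly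
#|X| neighbours, and each of them has at least two neighbours in [X].  Counting
edges between the two sets, 2 #|X| in total, shows that it has exactly two. *)
Lemma alternating_subgraph : #|[set v | deg v == k]| < #|[set v | deg v == 2]| ->
  exists X : {set V}, [/\ X != set0, forall x, x \in X -> deg x = 2 &
    forall y, y \in reach X -> #|nbrs y :&: X| = 2].
Proof.
set X2 := [set v | deg v == 2] => many.
have reach2 (X : {set V}) x : x \in X -> X \subset X2 -> 2 <= #|reach X|.
  move=> xX /subsetP/(_ x xX); rewrite inE => /eqP dx.
  rewrite -dx -card_nbrs //; apply: subset_leq_card; apply/subsetP => y yx.
  by apply/reachP; exists x.
pose P (X : {set V}) := [&& X != set0, X \subset X2 & #|reach X| <= #|X|].
have P2 : P X2.
  rewrite /P subxx -card_gt0 (leq_ltn_trans _ many) //=.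
  apply: leq_trans (ltnW many); apply: subset_leq_card; apply/subsetP => y /reachP[x xX yx].
  by move: xX; rewrite !in_set => /eqP dx; rewrite (nbr2 dx yx).
case: (arg_minnP (fun X : {set V} => #|X|) P2) => X /and3P[X0 XX2 reachX] minX.
have deg2 x : x \in X -> deg x = 2.
  by move=> xX; have := subsetP XX2 x xX; rewrite inE => /eqP.
have [x0 x0X] := set0Pn _ X0.
have X_gt1 : 1 < #|X| by apply: leq_trans reachX; apply: reach2 x0X XX2.
have sub_reach x : reach (X :\ x) \subset reach X.
  apply/subsetP => y /reachP[z]; rewrite inE => /andP[_ zX] yz.
  by apply/reachP; exists z.
have drop x : x \in X -> #|X| <= #|reach (X :\ x)|.
  move=> xX; rewrite leqNgt; apply/negP => lt.
  have cX := cardsD1 x X; rewrite xX add1n in cX.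
  have PX : P (X :\ x).
    rewrite /P -card_gt0 (subset_trans (subsetDl _ _) XX2).
    by move: lt X_gt1; rewrite cX; lia.
  by have := minX _ PX; rewrite cX; lia.
have cR : #|reach X| = #|X|.
  by apply/eqP; rewrite eqn_leq reachX (leq_trans (drop _ x0X)) // subset_leq_card.
have ge2 y : y \in reach X -> 2 <= #|nbrs y :&: X|.
  move=> yR; have [x xX yx] := reachP _ _ yR.
  have xI : x \in nbrs y :&: X by rewrite inE xX andbT nbrs_sym.
  rewrite ltnNge; apply/negP => le1.
  have yN : y \notin reach (X :\ x).
    apply/reachP => -[z]; rewrite !inE => /andP[zx zX] yz.
    have zI : z \in nbrs y :&: X by rewrite in_setI zX andbT nbrs_sym inE.
    by case/negP: zx; apply/eqP/(card_le1_eqP le1).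
  have := subset_leq_card (_ : y |: reach (X :\ x) \subset reach X).
  rewrite subUset sub1set yR sub_reach cardsU1 yN add1n cR => /(_ isT).
  by rewrite ltnNge drop.
have sum_cross : \sum_(y in reach X) #|nbrs y :&: X| = \sum_(y in reach X) 2.
  rewrite sum_nat_const cR.
  under eq_bigr do rewrite -sum1_card.
  rewrite (exchange_big_dep (mem X)) /=; last by move=> y x _; rewrite inE => /andP[].
  rewrite -sum_nat_const; apply: eq_bigr => x xX.
  rewrite -(deg2 _ xX) -card_nbrs // sum1dep_card; apply: eq_card => y.
  rewrite in_set in_setI xX andbT nbrs_sym; apply: andb_idl => yx.
  by apply/reachP; exists x.
exists X; split=> // y yR; apply/eqP; rewrite eqn_leq ge2 // andbT.
move: sum_cross; rewrite (big_setD1 y) // [RHS](big_setD1 y) //= => e.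
have : \sum_(z in reach X :\ y) 2 <= \sum_(z in reach X :\ y) #|nbrs z :&: X|.
  by apply: leq_sum => z; rewrite inE => /andP[_ zR]; apply: ge2.
by lia.
Qed.
End Alternator.

Section Coloring.
Variables (V : finType) (C : choiceType) (k : nat).
Variables (Lv : V -> {fset C}) (Le : {set V} -> {fset C}).
Hypothesis Lv_size : forall v, k < #|` Lv v|.
Implicit Types (F : {set {set V}}) (X : {set V}) (e : {set V}).

(** A proper total colouring from the lists, except that the vertices in [X] count
as uncoloured.  Functions on all sets of vertices colour the edges; only their
values on [F] matter. *)
Definition total_coloring_off F X (cv : V -> C) (ce : {set V} -> C) : Prop :=
  [/\ forall v, v \notin X -> cv v \in Lv v, forall e, e \in F -> ce e \in Le e,
    forall u v, u \notin X -> v \notin X -> u \in nbrs F v -> cv u != cv v,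
    forall e v, e \in F -> v \in e -> v \notin X -> ce e != cv v &
    forall e f v, e \in F -> f \in F -> e != f -> v \in e -> v \in f -> ce e != ce f].

Lemma leftover_size (A : {fset C}) (s : seq C) n : n + size s <= #|` A| -> 
  n <= size [seq c <- A | c \notin s].
Proof.
move=> le; rewrite size_filter.
have e : count (mem s) A + count (fun c => c \notin s) A = #|` A| := count_predC (mem s) A.
rewrite -(leq_add2l (count (mem s) A)) e (leq_trans _ le) // addnC leq_add2l.
rewrite -size_filter; apply: uniq_leq_size; first by rewrite filter_uniq.
by move=> c; rewrite mem_filter => /andP[].
Qed.

Lemma fresh_color (A : {fset C}) (s : seq C) : size s < #|` A| -> exists2 c, c \in A & c \notin s.
Proof.
move=> lt; have : 1 <= size [seq c <- A | c \notin s] by apply: leftover_size; rewrite add1n.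
by rewrite size_filter -has_count => /hasP[c cA cs]; exists c.
Qed.

(** An uncoloured vertex sees at most 2 deg x colours, on its edges and on its
neighbours, and independence allows to choose for all of [X] at once. *)
Lemma color_remaining_vertices F X cv ce : simple_edges F ->
  (forall x, x \in X -> 2 * deg F x <= k) ->
  (forall x y, x \in X -> y \in nbrs F x -> y \notin X) ->
  total_coloring_off F X cv ce -> exists cv', total_coloring_off F set0 cv' ce.
Proof.
move=> simpleF degX indepX [c1 c2 c3 c4 c5].
pose used x := [seq ce e | e <- enum (star F x)] ++ [seq cv y | y <- enum (nbrs F x)].
have ex x : exists c, if x \in X then (c \in Lv x) && (c \notin used x) else c == cv x.
  have [xX|_] := boolP (x \in X); last by exists (cv x).
  have [|c cL cu] := @fresh_color (Lv x) (used x); last by exists c; rewrite cL.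
  rewrite size_cat !size_map -!cardE card_nbrs // -/(deg F x).
  by apply: leq_ltn_trans (Lv_size x); have := degX x xX; lia.
have [cv' cv'P] := fin_all_exists ex.
have onX x : x \in X -> [/\ cv' x \in Lv x, forall e, e \in F -> x \in e -> ce e != cv' x &
    forall y, y \in nbrs F x -> cv y != cv' x].
  move=> xX; have := cv'P x; rewrite xX mem_cat negb_or => /and3P[xL xe xn]; split=> //.
    move=> e eF xin; apply: contraNneq xe => <-; apply: map_f.
    by rewrite mem_enum inE eF.
  by move=> y yx; apply: contraNneq xn => <-; apply: map_f; rewrite mem_enum.
have offX x : x \notin X -> cv' x = cv x.
  by move=> xX; have := cv'P x; rewrite (negbTE xX) => /eqP.
exists cv'; split=> //.
- move=> v _; have [vX|vX] := boolP (v \in X); first by case: (onX v vX).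
  by rewrite offX // c1.
- move=> u v _ _ uv; have [vX|vX] := boolP (v \in X).
    have [_ _ H] := onX v vX; rewrite offX ?(indepX v) //; exact: H.
  have [uX|uX] := boolP (u \in X); last by rewrite !offX // c3.
  have [_ _ H] := onX u uX; rewrite eq_sym offX // H // nbrs_sym //.
- move=> e v eF ve _; have [vX|vX] := boolP (v \in X).
    by have [_ H _] := onX v vX; apply: H.
  by rewrite offX // c4.
Qed.

Lemma extend_light_edge F u v cv ce : simple_edges F -> u \in nbrs F v ->
  (forall e, e \in F -> k < #|` Le e|) ->
  2 * deg F u <= k -> deg F u + deg F v <= k.+1 ->
  total_coloring_off (F :\ [set v; u]) set0 cv ce ->
  exists cv' ce', total_coloring_off F set0 cv' ce'.
Proof.
move=> simpleF; rewrite inE => /andP[uv eF] Le_size du duv [c1 c2 c3 c4 c5].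
set e0 := [set v; u] in eF c2 c3 c4 c5.
have ve0 : v \in e0 by rewrite !inE eqxx.
have ue0 : u \in e0 by rewrite !inE eqxx orbT.
pose used := cv v :: [seq ce e | e <- enum (star F u :\ e0)] ++ [seq ce e | e <- enum (star F v :\ e0)].
have [|c cL] := @fresh_color (Le e0) used.
  rewrite /= size_cat !size_map -!cardE; apply: leq_ltn_trans (Le_size _ eF).
  have := cardsD1 e0 (star F u); have := cardsD1 e0 (star F v).
  have -> : e0 \in star F u by rewrite inE eF.
  have -> : e0 \in star F v by rewrite inE eF.
  rewrite -/(deg F u) -/(deg F v) /=.
  by move=> ev eu; move: duv; rewrite ev eu !add1n addSn addnS !ltnS.
rewrite inE mem_cat !negb_or => /and3P[cv_v cu cv_].
pose ce' e := if e == e0 then c else ce e.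
have fresh f w : f \in F -> f != e0 -> w \in e0 -> w \in f -> ce f != c.
  move=> fF fe we wf; move: we; rewrite !inE => /orP[]/eqP E; rewrite E in wf.
    by apply: contraNneq cv_ => <-; apply: map_f; rewrite mem_enum !inE fe fF.
  by apply: contraNneq cu => <-; apply: map_f; rewrite mem_enum !inE fe fF.
have [|||cv' H] := @color_remaining_vertices F [set u] cv ce' simpleF; last by exists cv', ce'.
- by move=> x /set1P ->.
- by move=> x y /set1P ->; rewrite !inE => /andP[].
- split.
  + by move=> w _; apply: c1; rewrite inE.
  + by move=> e eF'; rewrite /ce'; case: eqVneq => [->//|ee]; apply: c2; rewrite !inE ee.
  + move=> x y; rewrite !in_set1 => xu yu; rewrite inE => /andP[xy xyF]; apply: c3; rewrite ?inE //.
    rewrite xy xyF andbT; apply/eqP => E; move: ue0; rewrite -E !inE.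
    by rewrite ![u == _]eq_sym (negbTE xu) (negbTE yu).
  + move=> e w eF' we; rewrite in_set1 => wu; rewrite /ce'; case: (eqVneq e e0) => [E|ee].
      by move: we; rewrite E !inE (negbTE wu) orbF => /eqP ->.
    by apply: c4; rewrite ?inE ?ee.
  + move=> e f w eF' fF ef we wf; rewrite /ce'.
    case: (eqVneq e e0) => [E|ee].
      rewrite E in we ef; rewrite eq_sym in ef.
      by rewrite (negbTE ef) eq_sym (fresh f w).
    case: (eqVneq f e0) => [E|fe]; first by rewrite (fresh e w) // -E.
    by apply: (c5 e f w); rewrite ?inE ?ee ?fe.
Qed.

(** The edges at [X] correspond to the pairs [d] of a vertex [p d] of [X] and a
neighbour [q d] of it.  Such an edge keeps at least two colours: outside [X] it
sees only the vertex [q d] and at most k - 2 edges there. *)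
Lemma extend_alternator F X cv ce : simple_edges F -> 4 <= k ->
  (forall e, e \in F -> k < #|` Le e|) -> (forall v, deg F v <= k) ->
  (forall x, x \in X -> deg F x = 2) ->
  (forall x y, x \in X -> y \in nbrs F x -> y \notin X) ->
  (forall y, y \in reach F X -> #|nbrs F y :&: X| = 2) ->
  total_coloring_off [set e in F | [disjoint e & X]] set0 cv ce ->
  exists cv' ce', total_coloring_off F set0 cv' ce'.
Proof.
move=> simpleF k4 Le_size degF deg2 indepX fib; set F' := [set e in F | _] => -[c1 c2 c3 c4 c5].
pose D := {d : V * V | (d.1 \in X) && (d.2 \in nbrs F d.1)}.
pose p (d : D) := (val d).1; pose q (d : D) := (val d).2.
have pX d : p d \in X by case/andP: (valP d).
have qp d : q d \in nbrs F (p d) by case/andP: (valP d).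
have qX d : q d \notin X by apply: indepX (qp d).
have qR d : q d \in reach F X by apply/reachP; exists (p d).
pose ed d := [set p d; q d].
have edF d : ed d \in F by have := qp d; rewrite inE => /andP[].
have ped d : p d \in ed d by rewrite !inE eqxx.
have qed_ d : q d \in ed d by rewrite !inE eqxx orbT.
have edX d : ~~ [disjoint ed d & X] by apply/pred0Pn; exists (p d); rewrite /= ped pX.
have edV d w : w \in ed d -> w = p d \/ w = q d by rewrite !inE => /orP[]/eqP; auto.
have ed_inj d d' : ed d = ed d' -> d = d'.
  move=> E; have e1 : p d = p d'.
    by have := ped d; rewrite E => /edV[//|pd]; have := qX d'; rewrite -pd pX.
  have e2 : q d = q d'.
    by have := qed_ d; rewrite E => /edV[pd|//]; have := qX d; rewrite pd pX.
  by apply: val_inj; move: e1 e2; rewrite /p /q; case: (val d) (val d') => [? ?] [? ?] /= -> ->.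
have edP e : e \in F -> e \notin F' -> exists d, e = ed d.
  rewrite inE => eF; rewrite eF /= => /pred0Pn[x /andP[/= xe xX]].
  have /cards2P[y [z [yz E]]] : #|e| == 2 by rewrite simpleF.
  have [w wx Ew] : exists2 w, w != x & e = [set x; w].
    move: xe; rewrite E !inE => /orP[]/eqP->; first by exists z; rewrite 1?eq_sym.
    by exists y; rewrite // setUC.
  have dP : (x \in X) && (w \in nbrs F x) by rewrite xX inE wx -Ew.
  by exists (Sub (x, w) dP).
have F'F e : e \in F' -> e \in F by rewrite inE => /andP[].
have F'X e w : e \in F' -> w \in e -> w \notin X.
  rewrite inE => /andP[_ dis] we; apply: contraL dis => wX.
  by apply/pred0Pn; exists w; rewrite /= we.
have edF' d : ed d \notin F' by rewrite inE (negbTE (edX d)) andbF.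
pose used (d : D) := cv (q d) :: [seq ce e | e <- enum (star F' (q d))].
pose Q d : seq C := [seq c <- Le (ed d) | c \notin used d].
have Qu d : uniq (Q d) by rewrite filter_uniq.
have Qs d : 1 < size (Q d).
  apply: leftover_size; apply: leq_trans (Le_size _ (edF d)).
  rewrite /= size_map -cardE.
  suff /leq_trans/(_ (degF (q d))) : #|star F' (q d)| + 2 <= deg F (q d) by rewrite add2n addn2 ltnS.
  rewrite -(fib _ (qR d)) -(@card_in_imset _ _ (fun x => [set x; q d]) (nbrs F (q d) :&: X)); last first.
    move=> x y; rewrite !inE => /andP[/andP[xq _] _] _ /setP/(_ x).
    by rewrite !inE eqxx (negbTE xq) /= orbF => /esym/eqP.
  set I := imset _ _; have dis : star F' (q d) :&: I = set0.
    apply/setP => e; rewrite in_setI in_set0; apply/negP => /andP[].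
    rewrite inE => /andP[eF' _] /imsetP[x]; rewrite inE => /andP[_ xX] E.
    by have := F'X e x eF'; rewrite xX E => /(_ _)/negP[] //; rewrite !inE eqxx.
  rewrite -cardsUI dis cards0 addn0; apply: subset_leq_card; apply/subsetP => e.
  rewrite inE => /orP[|/imsetP[x]].
    by rewrite !inE => /andP[/andP[-> _] ->].
  by rewrite inE => /andP[xq _] ->; move: xq; rewrite !inE eqxx orbT andbT setUC => /andP[].
have fp d : #|[set d' | p d' == p d]| = 2.
  rewrite -(deg2 _ (pX d)) -card_nbrs // -(@card_in_imset _ _ q).
    apply: eq_card => y; apply/imsetP/idP => [[d']|yp].
      by rewrite inE => /eqP <- ->; apply: qp.
    have dP : (p d \in X) && (y \in nbrs F (p d)) by rewrite pX.
    by exists (Sub (p d, y) dP : D); rewrite ?inE.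
  by move=> d1 d2; rewrite !inE => /eqP e1 /eqP e2 e; apply: ed_inj; rewrite /ed e1 e2 e.
have fq d : #|[set d' | q d' == q d]| = 2.
  rewrite -(fib _ (qR d)) // -(@card_in_imset _ _ p).
    apply: eq_card => x; apply/imsetP/idP => [[d']|].
      by rewrite in_set in_setI => /eqP <- ->; rewrite pX andbT nbrs_sym qp.
    rewrite inE => /andP[xq xX].
    have dP : (x \in X) && (q d \in nbrs F x) by rewrite xX nbrs_sym.
    by exists (Sub (x, q d) dP : D); rewrite ?inE.
  by move=> d1 d2; rewrite !inE => /eqP e1 /eqP e2 e; apply: ed_inj; rewrite /ed e1 e2 e.
have [c cQ cP] := two_regular_choosable fp fq Qu Qs.
have cL d : c d \in Le (ed d) by have := cQ d; rewrite mem_filter => /andP[].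
have cv_q d : c d != cv (q d).
  by have := cQ d; rewrite mem_filter inE negb_or => /andP[/andP[]].
have ce_q d f w : f \in F' -> w \in ed d -> w \in f -> c d != ce f.
  move=> fF' wd wf; have wq : w = q d.
    by have [wp|//] := edV _ _ wd; have := F'X _ _ fF' wf; rewrite wp pX.
  have := cQ d; rewrite mem_filter inE negb_or => /andP[/andP[_ cs] _].
  by apply: contraNneq cs => ->; apply: map_f; rewrite mem_enum inE fF' -wq.
pose ce' e := if [pick d | e == ed d] is Some d then c d else ce e.
have ce'd d : ce' (ed d) = c d.
  rewrite /ce'; case: pickP => [d' /eqP/ed_inj -> //|/(_ d)]; by rewrite eqxx.
have ce'F' e : e \in F' -> ce' e = ce e.
  move=> eF'; rewrite /ce'; case: pickP => // d /eqP E.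
  by have := edF' d; rewrite -E eF'.
have [|||cv' H] := @color_remaining_vertices F X cv ce' simpleF; last by exists cv', ce'.
- by move=> x /deg2 ->.
- exact: indepX.
- split.
  + by move=> v _; apply: c1; rewrite inE.
  + move=> e eF; have [eF'|/(edP _ eF)[d ->]] := boolP (e \in F'); last by rewrite ce'd.
    by rewrite ce'F' // c2.
  + move=> u v uX vX; rewrite inE => /andP[uv eF]; apply: c3; rewrite ?inE //.
    rewrite uv eF; apply/pred0P => w /=; rewrite !inE.
    by apply/negP => /andP[/orP[]/eqP-> ]; rewrite ?(negbTE uX) ?(negbTE vX).
  + move=> e v eF ve vX; have [eF'|/(edP _ eF)[d E]] := boolP (e \in F').
      by rewrite ce'F' // c4 // inE.
    rewrite E ce'd; rewrite E in ve; have [vp|->//] := edV _ _ ve.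
    by rewrite vp pX in vX.
  + move=> e f v eF fF ef ve vf.
    have [eF'|/(edP _ eF)[d E]] := boolP (e \in F'); last first.
      rewrite E ce'd; rewrite E in ve.
      have [fF'|/(edP _ fF)[d' E']] := boolP (f \in F'); first by rewrite ce'F' // (ce_q d f v).
      rewrite E' ce'd; rewrite E' in vf; apply: cP.
        by apply: contraNneq ef => dd; rewrite E E' dd.
      have [v1|v1] := edV _ _ ve; have [v2|v2] := edV _ _ vf.
      * by left; rewrite -v1.
      * by have := qX d'; rewrite -v2 v1 pX.
      * by have := qX d; rewrite -v1 v2 pX.
      * by right; rewrite -v1.
    have [fF'|/(edP _ fF)[d' E']] := boolP (f \in F'); first by rewrite !ce'F' // (c5 e f v).
    by rewrite E' ce'd ce'F' // eq_sym (ce_q d' e v) // -E'.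
Qed.

End Coloring.

(** The colour [c0] only serves to define the colouring of the empty set of edges. *)
Lemma total_list_colorable (V : finType) (C : choiceType) (k : nat)
    (Lv : V -> {fset C}) (Le : {set V} -> {fset C}) (c0 : C) (F : {set {set V}}) :
  9 <= k -> (forall v, k < #|` Lv v|) -> (forall e, e \in F -> k < #|` Le e|) ->
  simple_edges F -> face_labelled F ->
  (forall T T' e, T \in triangles F -> T' \in triangles F ->
    e \in F -> e \subset T -> e \subset T' -> T = T') ->
  (forall v, deg F v <= k) ->
  exists cv ce, total_coloring_off Lv Le F set0 cv ce.
Proof.
move=> k9 Lv_size; have [m] := ubnP #|F|; elim: m F => // m IH F Fm Le_size simpleF labF kiteF degF.
have sub (F' : {set {set V}}) : F' \proper F -> exists cv ce, total_coloring_off Lv Le F' set0 cv ce.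
  move=> /[dup] pF /proper_sub sF; have sF' := subsetP sF; apply: IH.
  - by rewrite -ltnS (leq_trans _ Fm) // ltnS proper_card.
  - by move=> e /sF'/Le_size.
  - by move=> e /sF'/simpleF.
  - exact: face_labelled_subset labF.
  - have sT T : T \in triangles F' -> T \in triangles F.
      rewrite !inE => /andP[-> /forallP TF] /=; apply/forallP => e; apply/implyP => h.
      by have := TF e; rewrite h /= => /sF'.
    by move=> T T' e /sT TF /sT TF' /sF'; apply: kiteF.
  - move=> v; apply: leq_trans (degF v); apply: subset_leq_card; apply/subsetP => e.
    by rewrite !inE => /andP[/sF' -> ->].
have [F0|F0] := eqVneq F set0.
  have ex v : exists c, c \in Lv v.
    by have [|c cL _] := @fresh_color _ (Lv v) [::]; [apply: leq_ltn_trans (Lv_size v)|exists c].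
  have [cv cvP] := fin_all_exists ex; exists cv, (fun=> c0).
  by split=> [v _|e|u v _ _|e v|e f v]; rewrite ?F0 ?inE ?andbF.
have [/existsP[u /existsP[v /and3P[uv du duv]]]|noLight] :=
  boolP [exists u, exists v, [&& u \in nbrs F v, deg F u <= 4 & deg F u + deg F v <= k.+1]].
  have [|cv [ce cP]] := sub (F :\ [set v; u]).
    by apply: properD1; move: uv; rewrite inE => /andP[].
  apply: (extend_light_edge Lv_size simpleF uv Le_size _ duv cP); lia.
have heavy u v : u \in nbrs F v -> deg F u <= 4 -> k + 2 <= deg F u + deg F v.
  move=> uv du; rewrite leqNgt; apply: contra noLight => lt.
  by apply/existsP; exists u; apply/existsP; exists v; rewrite uv du /=; move: lt; lia.
have nbr2 u v : deg F u = 2 -> v \in nbrs F u -> deg F v = k.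
  move=> du; rewrite nbrs_sym => uv; have := heavy u v uv; rewrite du => /(_ isT).
  by have := degF v; lia.
have many := many_deg2 simpleF kiteF k9 degF heavy F0 labF.
have [X [X0 deg2 fib]] := alternating_subgraph simpleF nbr2 many.
have [|cv [ce cP]] := sub [set e in F | [disjoint e & X]].
  have [x xX] := set0Pn _ X0; have : 0 < #|star F x| by rewrite -/(deg F x) deg2.
  rewrite card_gt0 => /set0Pn[e]; rewrite inE => /andP[eF xe].
  apply/properP; split; first by apply/subsetP => f; rewrite inE => /andP[].
  exists e; rewrite // inE eF /=; apply/pred0Pn; exists x; by rewrite /= xe.
apply: (extend_alternator Lv_size simpleF _ Le_size degF deg2 _ fib cP); first lia.
move=> x y xX yx; apply/negP => yX; have := nbr2 x y (deg2 x xX) yx.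
by rewrite (deg2 y yX); lia.
Qed.

(** * The list total chromatic number *)

Section Graph.
Variable G : sgraph.

Lemma mem_edges (x y : G) : x != y -> ([set x; y] \in edges G) = adj x y.
Proof.
move=> xy; rewrite inE; apply/existsP/idP => [[a /existsP[b /andP[ab /eqP e]]]|xy_adj].
  have : x \in [set a; b] by rewrite -e !inE eqxx.
  have : y \in [set a; b] by rewrite -e !inE eqxx orbT.
  rewrite !inE => /orP[]/eqP ya /orP[]/eqP xa; move: xy; rewrite ya xa ?eqxx // => _.
  by rewrite adj_sym.
by exists x; apply/existsP; exists y; rewrite xy_adj eqxx.
Qed.

Lemma simple_edges_graph : simple_edges (edges G).
Proof.
move=> e; rewrite inE => /existsP[a /existsP[b /andP[ab /eqP ->]]].
by rewrite cards2; case: eqP ab => // ->; rewrite adj_irrefl.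
Qed.

Lemma deg_degree (v : G) : deg (edges G) v = degree v.
Proof.
rewrite -card_nbrs; last exact: simple_edges_graph.
apply: eq_card => y; rewrite [LHS]in_set [RHS]in_set.
case: (eqVneq y v) => [->|yv]; first by rewrite adj_irrefl.
by rewrite mem_edges // eq_sym.
Qed.

Lemma triangles_triangle (T : {set G}) : T \in triangles (edges G) -> triangle T.
Proof.
move=> TF; rewrite /triangle (triangle_card TF) /=; apply/forall_inP => x xT.
apply/forall_inP => y yT; apply/implyP => xy.
by rewrite -mem_edges // (triangle_edge TF).
Qed.

Lemma card_incident_edges (v : G) : #|[set e : edge G | v \in val e]| = degree v.
Proof.
rewrite -deg_degree -sum1dep_card (sum_edges addn (fun=> 1) v) sum1dep_card.
by apply: eq_card => e; rewrite !inE.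
Qed.

(** Give all elements the same list of [j] colours: the vertex and the edges at it
receive distinct colours. *)
Lemma total_choosable_gt_degree (v : G) j : total_choosable G j -> degree v < j.
Proof.
move=> /(_ 'I_j (fun=> [fset i in enum 'I_j]%fset))[|c proper _].
  by move=> _; rewrite card_fseq undup_id ?enum_uniq // size_enum_ord.
pose A : {set G + edge G} := inl v |: [set inr e | e in [set e : edge G | v \in val e]].
have cA : #|A| = (degree v).+1.
  rewrite cardsU1 card_imset ?card_incident_edges; last by move=> e f [].
  by rewrite (_ : inl v \notin _) //; apply/imsetP => -[].
rewrite -cA -[leqRHS]card_ord -(@card_in_imset _ _ c A) ?max_card //.
have inA b : b \in A -> b = inl v \/ exists2 e : edge G, v \in val e & b = inr e.
  rewrite in_setU1 => /orP[/eqP|/imsetP[e]]; first by left.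
  by rewrite inE => ve ->; right; exists e.
move=> a b /inA[->|[e ve ->]] /inA[->|[f vf ->]] // eq_c.
- by have := proper (inl v) (inr f) vf; rewrite eq_c eqxx.
- by have := proper (inr e) (inl v) ve; rewrite eq_c eqxx.
congr inr; apply/eqP/negPn/negP => ef.
suff : conflict (inr e : element G) (inr f) by move/proper; rewrite eq_c eqxx.
by rewrite /= ef; apply/set0Pn; exists v; rewrite inE ve.
Qed.

End Graph.

Theorem theorem15 (R : realType) (G : sgraph)
  (planarG : planar R G) (kite_freeG : kite_free G)
  (max_degreeG : 9 <= max_degree G) :
  is_list_total_chromatic_number G (max_degree G).+1.
Proof.
have G_gt0 : 0 < #|G|.
  rewrite lt0n; apply/eqP => G0; move: max_degreeG; rewrite /max_degree big_pred0 // => x.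
  by have := card0_eq G0 x.
have [v0 max_v0] := @bigop.eq_bigmax G (@degree G) G_gt0.
split; last by move=> j /total_choosable_gt_degree; rewrite /max_degree max_v0; apply.
move=> C L L_size.
pose Le (e : {set G}) := if insub e is Some e' then L (inr e') else fset0%fset.
have LeE (e : edge G) : Le (val e) = L (inr e) by rewrite /Le valK.
have [|c0 _ _] := @fresh_color C (L (inl v0)) [::].
  by apply: leq_trans (L_size (inl v0)).
have [||||||cv [ce [cvL ceL cvv cev cee]]] :=
    @total_list_colorable G C (max_degree G) (fun v => L (inl v)) Le c0 (edges G) max_degreeG.
- by move=> v; apply: L_size.
- by move=> e eG; rewrite -[e]/(val (Sub e eG : edge G)) LeE; apply: L_size.
- exact: simple_edges_graph.
- exact: planar_face_labelled planarG.
- by move=> T T' e /triangles_triangle TG /triangles_triangle TG'; apply: kite_freeG.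
- by move=> v; rewrite deg_degree; apply: leq_bigmax.
have off (v : G) : v \notin (set0 : {set G}) by rewrite inE.
exists (fun a : element G => match a with inl v => cv v | inr e => ce (val e) end); last first.
  by case=> [v|e] /=; [apply: cvL|rewrite -LeE; apply: ceL (valP e)].
case=> [x|e] [y|f] /=.
- move=> xy; apply: cvv => //; rewrite inE.
  have ne : x != y by apply: contraTneq xy => ->; rewrite adj_irrefl.
  by rewrite ne setUC mem_edges.
- by move=> xf; rewrite eq_sym cev // (valP f).
- by move=> ye; rewrite cev // (valP e).
- move=> /andP[ef /set0Pn[v]]; rewrite inE => /andP[ve vf].
  by apply: (cee _ _ v); rewrite ?(valP e) ?(valP f).
Qed.
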